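(* Let $d\in\mathbb{N}$, $\tilde\lambda_1,\dots,\tilde\lambda_d>0$, and let $\tilde N_s=\{\tilde N_s(t):t\ge0\}$, $s=1,\dots,d$, be independent homogeneous Poisson processes with intensities $\tilde\lambda_s$. Let $\overrightarrow{\tilde U}_i=(\tilde U_{i1},\dots,\tilde U_{id})$, $i=1,2,\dots$, be i.i.d. random vectors with independent non-negative integer-valued coordinates, independent of $(\tilde N_1,\dots,\tilde N_d)$. For each $i$ let $A_{i1},\dots,A_{id}$ be a partition of the sample space with $\mathbb{P}(A_{is})=\tilde\lambda_s/(\tilde\lambda_1+\dots+\tilde\lambda_d)$, these partitions being independent for different $i$ and independent of the vectors $\overrightarrow{\tilde U}_1,\overrightarrow{\tilde U}_2,\dots$. Put $$p_0=\frac{\sum_{s=1}^d\mathbb{P}(\tilde U_{1s}=0)\tilde\lambda_s}{\tilde\lambda_1+\dots+\tilde\lambda_d}$$ and assume $p_0<1$. Let $\overrightarrow U_i=(U_{i1},\dots,U_{id})$, $i=1,2,\dots$, be i.i.d. random vectors distributed as $(I\{A_{11}\}\tilde U_{11},\dots,I\{A_{1d}\}\tilde U_{1d})$ conditioned on this vector being different from $(0,\dots,0)$, and let $N=\{N(t):t\ge0\}$ be a homogeneous Poisson process with intensity $(\tilde\lambda_1+\dots+\tilde\lambda_d)(1-p_0)$, independent of $\overrightarrow U_1,\overrightarrow U_2,\dots$. For $t\ge0$ and $s=1,\dots,d$ set $$\tilde N_{c,s}(t)=I\{\tilde N_s(t)>0\}\sum_{i=1}^{\tilde N_s(t)}\tilde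 U_{is},\qquad N_{c,s}(t)=I\{N(t)>0\}\sum_{i=1}^{N(t)}U_{is}.$$ Then the vector-valued processes $(N_{c,1},\dots,N_{c,d})$ and $(\tilde N_{c,1},\dots,\tilde N_{c,d})$ have the same finite-dimensional distributions.
   Context: $I\{\cdot\}$ is the indicator function; a sum multiplied by an indicator that equals $0$ is read as $0$. *)

(* Defs.v *)
From HB Require Import structures.
From mathcomp Require Import all_boot all_order all_algebra finmap.
From mathcomp Require Import all_classical all_reals all_analysis.

Set Implicit Arguments.
Unset Strict Implicit.
Unset Printing Implicit Defensive.

Import Order.TTheory GRing.Theory Num.Theory.
Import numFieldNormedType.Exports.

Local Open Scope classical_set_scope.
Local Open Scope ring_scope.

Definition sigma_of {dE} {T I : Type} {E : measurableType dE}
    (X : I -> T -> E) : set (set T) :=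
  <<s \bigcup_i preimage_set_system setT (X i) measurable >>.

(* The product rule is required for every finite subfamily J; when each F i is
   a sigma-algebra this is mutual independence. *)
Definition mutual_indep {d} {T : measurableType d} {R : realType}
    (P : probability T R) {I : choiceType} (F : I -> set (set T)) : Prop :=
  forall (J : {fset I}) (E : I -> set T), (forall i, i \in J -> F i (E i)) ->
  P (\bigcap_(i in [set` J]) E i) = (\prod_(i <- J) P (E i))%E.

Definition indep {d} {T : measurableType d} {R : realType}
    (P : probability T R) (F G : set (set T)) : Prop :=
  forall A B : set T, F A -> G B -> P (A `&` B) = (P A * P B)%E.

Definition cond_prob {d} {T : measurableType d} {R : realType}
    (P : probability T R) (A B : set T) : \bar R := (P (A `&` B) / P B)%E.

Section poisson_process.
Context {d} {T : measurableType d} {R : realType} (P : probability T R).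

(* Paths start at 0, are nondecreasing and are right-continuous; the latter
   means locally constant to the right, since the values are in nat. *)
Definition counting_process (N : {nonneg R} -> {RV P >-> nat}) : Prop :=
  forall w : T,
  [/\ N 0%:nng w = 0%N,
      {homo (fun t => N t w) : s t / s <= t >-> (s <= t)%N} &
      forall t : {nonneg R}, exists2 e : R, 0 < e &
        forall u : {nonneg R}, t%:num <= u%:num < t%:num + e -> N u w = N t w].

Definition increment (N : {nonneg R} -> {RV P >-> nat}) (s t : {nonneg R})
  (w : T) : nat := (N t w - N s w)%N.

(* Independence of the increments along an infinite nondecreasing sequence of
   times covers all finite sequences t_0 <= ... <= t_n (extend by constants). *)
Definition independent_increments (N : {nonneg R} -> {RV P >-> nat}) : Prop :=
  forall t : nat -> {nonneg R}, nondecreasing_seq t ->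
  mutual_indep P
    (fun k : nat => sigma_of (fun _ : unit => increment N (t k) (t k.+1))).

Definition poisson_process (rate : R) (N : {nonneg R} -> {RV P >-> nat}) :
    Prop :=
  [/\ counting_process N, independent_increments N &
      forall (s t : {nonneg R}) (k : nat), s < t ->
        P [set w | increment N s t w = k] =
        (poisson_pmf (rate * (t%:num - s%:num)) k)%:E].

End poisson_process.

Definition zero_tuple (d : nat) : d.-tuple nat := [tuple 0%N | s < d].

Definition select {T : Type} {d : nat} (A : 'I_d -> set T)
    (U : T -> d.-tuple nat) (w : T) : d.-tuple nat :=
  [tuple ((w \in A s) * tnth (U w) s)%N | s < d].

Definition compound_process {R : realType} {T : Type} {d : nat}
    (N : 'I_d -> {nonneg R} -> T -> nat) (U : nat -> T -> d.-tuple nat)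
    (t : {nonneg R}) (w : T) : d.-tuple nat :=
  [tuple ((0 < N s t w) * \sum_(i < N s t w) tnth (U i w) s)%N | s < d].

Definition same_fdd {d1 d2 dE} {T1 : measurableType d1} {T2 : measurableType d2}
    {R : realType} (P1 : probability T1 R) (P2 : probability T2 R)
    {I : Type} {E : measurableType dE} (X : I -> T1 -> E) (Y : I -> T2 -> E) :
    Prop :=
  forall (n : nat) (t : n.-tuple I) (B : set (n.-tuple E)), measurable B ->
  P1 [set w | B [tuple X (tnth t k) w | k < n]] =
  P2 [set w | B [tuple Y (tnth t k) w | k < n]].

(* Main.v *)
(* Both processes start at 0 and have independent increments, so the law of a
   path observed at times t_0 < ... < t_K is a product of one-interval laws. On
   an interval of length t the increment of the first process is compound
   Poisson on N^d, with intensity L (1 - p0) t, where L is the sum of the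
   lam_s, and jump law nu; the increment of the second one has independent
   coordinates, the s-th being compound Poisson with intensity lam_s t and a
   jump law mu_s, which we place on the s-th axis of N^d. A compound Poisson law
   g with intensity th and jump law mu is determined by g(0) and by Panjer's
   recursion v_s g(v) = th sum_(u <= v) u_s mu(u) g(v - u). Since
   L (1 - p0) nu(u) = sum_s lam_s mu_s(u) for u <> 0, the two increment laws
   satisfy the same recursion. *)
Require Import Defs.
From mathcomp Require Import all_boot all_order all_algebra finmap.
From mathcomp Require Import all_classical all_reals all_analysis.
From mathcomp Require Import zify ring.

Set Implicit Arguments.
Unset Strict Implicit.
Unset Printing Implicit Defensive.

Import Order.TTheory GRing.Theory Num.Theory.
Import numFieldNormedType.Exports.

Local Open Scope classical_set_scope.
Local Open Scope ring_scope.

(** * Compound Poisson laws on N^d *)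

(** The product form of the path laws has an obstacle: the jumps used on a new interval start at a
    random index, the count reached so far. Once that count is fixed, the past reads finitely many
    variables, and the new block consists of fresh jumps whose law does not depend on where the
    block starts. In the second process the coordinates have consumed different numbers of jumps by
    the same time, so they share no starting index and must be advanced separately. Panjer's
    recursion takes the place of generating functions, or of a coupling with a marked superposition.
    It is linear in th mu, so jump intensities can be compared directly. The weight u_s kills the
    mass of mu at 0, which therefore enters only through g(0). A product of laws carried by
    different axes fits in because its s-th recursion acts on the s-th factor alone. Sums are taken
    in the extended reals with nonnegative terms, so they can be rearranged without any summability
    argument. *)

Lemma ge0_esumZl (R : realType) (T : choiceType) (S : set T)
    (a : T -> \bar R) (c : R) : 0 <= c -> (forall i, 0 <= a i)%E ->
  (\esum_(i in S) (c%:E * a i) = c%:E * \esum_(i in S) a i)%E.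
Proof.
move=> c0 a0; rewrite /esum -ereal_supZl//; last first.
  by apply/set0P/image_nonempty; exists set0; exact: fsets_set0.
congr ereal_sup; apply/seteqP; split => [_ [X [fX XS] <-]|_ [_ [X [fX XS] <-] <-]].
  exists (\sum_(x \in X) a x)%E; first by exists X.
  by rewrite ge0_mule_fsumr.
exists X => //.
by rewrite ge0_mule_fsumr.
Qed.

Section vectors.
Context {D : finType}.
Implicit Types u v w : {ffun D -> nat}.

Definition vle u v := [forall s, (u s <= v s)%N].

(** Truncated in each coordinate, hence a true difference only under [vle u v]. *)
Definition vsub v u : {ffun D -> nat} := [ffun s => (v s - u s)%N].

Lemma vleP {u v} : reflect (forall s, (u s <= v s)%N) (vle u v).
Proof. exact: forallP. Qed.

Lemma vle_sub_swap u w v : vle u v && vle w (vsub v u) = vle w v && vle u (vsub v w).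
Proof.
apply/andP/andP => -[/vleP h /vleP k]; split; apply/vleP => s;
  move: (h s) (k s); rewrite !ffunE; lia.
Qed.

Lemma vsubC u w v : vsub (vsub v u) w = vsub (vsub v w) u.
Proof. by apply/ffunP => s; rewrite !ffunE subnAC. Qed.

Lemma vaddE u w v : (u + w == v) = vle u v && (w == vsub v u).
Proof.
apply/eqP/andP => [<-|[/vleP h /eqP ->]]; last first.
  by apply/ffunP => s; rewrite !ffunE; exact: subnKC.
split; first by apply/vleP => s; rewrite !ffunE; exact: leq_addr.
by apply/eqP/ffunP => s; rewrite !ffunE; apply/esym; exact: addKn.
Qed.

End vectors.

Section convolution_powers.
Context {R : realType} {D : finType}.
Notation V := {ffun D -> nat}.
Variable mu : V -> R.
Hypothesis mu_ge0 : forall u, 0 <= mu u.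
Local Open Scope ereal_scope.

Local Ltac ge0 := intros; repeat first
  [ apply: mule_ge0 | apply: esum_ge0; intros | rewrite lee_fin | apply: mulr_ge0 ];
  auto.

(** The mass at v of a sum of m independent vectors with law [mu]; the vector u is the first
    summand. *)
Fixpoint conv_pow (m : nat) (v : V) : \bar R :=
  if m is m'.+1 then
    \esum_(u in [set u | vle u v]) ((mu u)%:E * conv_pow m' (vsub v u))
  else ((v == 0)%:R)%:E.

Lemma conv_pow_ge0 m v : 0 <= conv_pow m v.
Proof.
elim: m v => [|m IH] v /=; first by rewrite lee_fin.
by apply: esum_ge0 => u _; rewrite mule_ge0 ?lee_fin.
Qed.

Lemma conv_pow_le1 m v : \esum_(u in [set: V]) (mu u)%:E <= 1 ->
  conv_pow m v <= 1.
Proof.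
move=> mu1; elim: m v => [|m IH] v /=; first by rewrite lee_fin; case: eqP.
apply: le_trans mu1; rewrite [leLHS]esum_mkcond; apply: le_esum => u _.
case: ifP => _; last by rewrite lee_fin.
by rewrite -[leRHS]mule1 lee_pmul ?conv_pow_ge0 ?lee_fin.
Qed.

(** Both sides run over the pairs with u + w <= v, a condition symmetric in u and w. *)
Lemma esum_swap (a : V -> V -> \bar R) v : (forall u w, 0 <= a u w) ->
  \esum_(u in [set u | vle u v]) \esum_(w in [set w | vle w (vsub v u)]) a u w =
  \esum_(w in [set w | vle w v]) \esum_(u in [set u | vle u (vsub v w)]) a u w.
Proof.
move=> a0; rewrite !esum_esum//.
rewrite (reindex_esum ([set u | vle u v] `*`` (fun u => [set w | vle w (vsub v u)]))
  _ (fun x => (x.2, x.1)))//; split => /=.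
- by move=> [u w] /= [h k]; apply/andP; rewrite -vle_sub_swap h.
- by move=> [u w] [u' w'] _ _ /= [-> ->].
- move=> [u w] /= [h k]; exists (w, u) => //=.
  by apply/andP; rewrite -vle_sub_swap h.
Qed.

(* Each of the m summands contributes equally to the s-coordinate of the sum. *)
Lemma conv_pow_weighted (s : D) m (v : V) :
  ((v s)%:R)%:E * conv_pow m v =
  \esum_(u in [set u | vle u v])
     ((m%:R)%:E * (((u s)%:R * mu u)%:E * conv_pow m.-1 (vsub v u))).
Proof.
have c0 := conv_pow_ge0.
have e0 (u : V) : 0 <= (((u s)%:R * mu u)%:E : \bar R) by rewrite lee_fin mulr_ge0.
elim: m v => [|m IH] v.
  rewrite esum1 => [|u _]; last by rewrite mul0e.
  by rewrite /=; case: eqP => [->|_]; rewrite ?mule0// ffunE mul0e.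
rewrite [conv_pow _ _]/= -ge0_esumZl//; last by ge0.
(* Split v_s into the share of the first summand u and that of the other m summands; the induction
   hypothesis treats the latter. *)
under eq_esum => u uv.
  have -> : ((v s)%:R)%:E = (((u s)%:R + (vsub v u s)%:R)%R : R)%:E.
    by rewrite ffunE -natrD subnKC//; move/vleP: uv.
  rewrite EFinD ge0_muleDl// 1?[((vsub v u s)%:R)%:E * _]muleCA ?lee_fin//.
  rewrite IH -ge0_esumZl//; last by ge0.
  over.
rewrite esumD; first last.
- by ge0.
- by ge0.
(* The weighted summand becomes the outer variable, so that the inner sum over the first summand
   rebuilds a convolution power. *)
rewrite esum_swap; last by ge0.
rewrite -esumD; first last.
- by ge0.
- by ge0.
apply: eq_esum => u uv /=.
under eq_esum => w wv.
  rewrite (muleCA _ (m%:R)%:E) (muleCA (mu w)%:E) vsubC; over.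
rewrite ge0_esumZl//; last by ge0.
rewrite ge0_esumZl; [|by ge0|by ge0].
rewrite -nat1r EFinD ge0_muleDl; [|by rewrite lee_fin|by rewrite lee_fin].
rewrite mul1e EFinM muleA.
(* [m.-1] is a true predecessor only for m > 0; for m = 0 the factor m vanishes. *)
case: m {IH} => [|m]; first by rewrite !mul0e.
by rewrite muleA.
Qed.

Lemma conv_pow0 m : conv_pow m 0%R = ((mu 0) ^+ m)%R%:E.
Proof.
elim: m => [|m IH]; first by rewrite /= eqxx expr0.
rewrite /= (_ : [set u | vle u 0%R] = [set 0%R]).
  rewrite esum_set1; last by rewrite mule_ge0 ?lee_fin// conv_pow_ge0.
  by rewrite (_ : vsub 0%R 0%R = 0%R) ?IH -?EFinM ?exprS//; apply/ffunP => s; rewrite !ffunE.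
apply/seteqP; split => [u /vleP h|u -> /=]; last by apply/vleP.
by apply/ffunP => s; move: (h s); rewrite !ffunE leqn0 => /eqP.
Qed.

Definition compound_poisson (th : R) (v : V) : \bar R :=
  \esum_(m in [set: nat]) ((poisson_pmf th m)%:E * conv_pow m v).

Lemma poisson_conv_ge0 (th : R) m v : 0 <= (poisson_pmf th m)%:E * conv_pow m v.
Proof. by rewrite mule_ge0 ?conv_pow_ge0// lee_fin poisson_pmf_ge0. Qed.

Lemma compound_poisson_ge0 (th : R) v : 0 <= compound_poisson th v.
Proof. by apply: esum_ge0 => m _; exact: poisson_conv_ge0. Qed.

Lemma esum_poisson_pmf (th : R) : (0 < th)%R ->
  \esum_(m in [set: nat]) (poisson_pmf th m)%:E = 1.
Proof.
by move=> th0; have := @probability_setT _ _ R (poisson_prob th 0);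
  rewrite /= /poisson_prob th0.
Qed.

Lemma compound_poisson_fin_num (th : R) v : (0 < th)%R ->
  \esum_(u in [set: V]) (mu u)%:E <= 1 -> compound_poisson th v \is a fin_num.
Proof.
move=> th0 mu1; rewrite ge0_fin_numE ?compound_poisson_ge0//.
apply: (@le_lt_trans _ _ 1); last exact: ltry.
rewrite -(esum_poisson_pmf th0); apply: le_esum => m _.
by rewrite -[leRHS]mule1 lee_pmul ?conv_pow_ge0 ?conv_pow_le1 ?lee_fin ?poisson_pmf_ge0.
Qed.

(** A sum of m jumps is 0 exactly when every jump is, which gives the weights mu(0)^m; they turn the
    Poisson series of rate th into a multiple of the one of rate th mu(0). *)
Lemma compound_poisson0 (th : R) : (0 < th)%R ->
  compound_poisson th 0%R = (expR (- (th * (1 - mu 0))))%R%:E.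
Proof.
move=> th0; rewrite /compound_poisson.
under eq_esum do rewrite conv_pow0.
(* The formula for [poisson_pmf] needs a positive rate, so th mu(0) = 0 is treated apart: only m = 0
   contributes. *)
have [mu00|mu0] := eqVneq (mu 0%R) 0%R.
  rewrite mu00 subr0 mulr1 (esumID [set 0%N]); last first.
    by move=> m _; rewrite mule_ge0 ?lee_fin ?exprn_ge0 ?poisson_pmf_ge0.
  rewrite setTI setTI esum_set1; last first.
    by rewrite mule_ge0 ?lee_fin ?exprn_ge0 ?poisson_pmf_ge0.
  rewrite esum1 => [|[|m] //= _]; last by rewrite expr0n mule0.
  by rewrite adde0 expr0 mule1 /poisson_pmf th0 expr0 fact0 invr1 !mul1r.
have mu0_gt0 : (0 < th * mu 0%R)%R by rewrite mulr_gt0// lt_neqAle eq_sym mu0/=.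
transitivity (\esum_(m in [set: nat])
   ((expR (- (th * (1 - mu 0))))%R%:E * (poisson_pmf (th * mu 0) m)%:E)).
  apply: eq_esum => m _; rewrite -!EFinM /poisson_pmf th0 mu0_gt0; congr EFin.
  have -> : (- (th * (1 - mu 0)) = - th + th * mu 0)%R by ring.
  rewrite expRD expRN (expRN (th * mu 0%R)%R) exprMn; field.
  by rewrite !gt_eqF ?expR_gt0//= ltr0n fact_gt0.
rewrite ge0_esumZl ?expR_ge0//; last by move=> m; rewrite lee_fin poisson_pmf_ge0.
by rewrite esum_poisson_pmf// mule1.
Qed.

(* Panjer's recursion. *)
Lemma compound_poisson_weighted (th : R) (s : D) (v : V) : (0 < th)%R ->
  ((v s)%:R)%:E * compound_poisson th v =
  \esum_(u in [set u | vle u v])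
     ((th * ((u s)%:R * mu u))%:E * compound_poisson th (vsub v u)).
Proof.
move=> th0.
have c0 := conv_pow_ge0; have p0 m := @poisson_pmf_ge0 R th m.
rewrite -ge0_esumZl//; last by ge0.
under eq_esum => m _.
  rewrite muleCA conv_pow_weighted -ge0_esumZl//; last by ge0.
  over.
rewrite esum_esum; last by ge0.
rewrite (reindex_esum ([set u | vle u v] `*`` (fun=> [set: nat])) _
  (fun x => (x.2, x.1))); last first.
  split => /=; first by move=> [u m] [].
  - by move=> [u m] [u' m'] _ _ /= [-> ->].
  - by move=> [m u] /= [_ uv]; exists (u, m).
rewrite -(esum_esum (a := fun (u : V) m => (poisson_pmf th m)%:E * ((m%:R)%:E *
    (((u s)%:R * mu u)%:E * conv_pow m.-1 (vsub v u))))); last by ge0.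
apply: eq_esum => u uv.
rewrite [in RHS]EFinM [in RHS](muleC th%:E) -[in RHS]muleA.
under eq_esum => m _.
  rewrite muleA muleCA; over.
rewrite ge0_esumZl; [|by ge0|by ge0].
congr (_ * _).
rewrite -ge0_esumZl ?(ltW th0)//; last by ge0.
(* The term m = 0 vanishes with its factor m. After a shift of the index, the Poisson weights
   satisfy (m + 1) p(m + 1) = th p(m). *)
rewrite (esumID [set 0%N]); last by ge0.
rewrite [X in X + _]esum1 => [|_ [_ ->]]; last by rewrite mule0 mul0e.
rewrite add0e (reindex_esum setT _ succn); last first.
  split; [by []|by move=> i j _ _ []|by move=> [|i] [_ //= _]; exists i].
apply: eq_esum => m _ /=; rewrite muleA -!EFinM; congr (_%:E * _).
rewrite /poisson_pmf th0 factS natrM exprS; field.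
by rewrite nat1r !pnatr_eq0 -lt0n fact_gt0.
Qed.

End convolution_powers.

(** At a nonzero v, read the recursion in a coordinate with v_s > 0. The condition on [c] removes
    the terms with u_s = 0, so only vectors v - u of smaller total size remain, and dividing by v_s
    determines the value. *)
Lemma weighted_recursion_unique (R : realType) (D : finType)
    (g h : {ffun D -> nat} -> \bar R) (c : D -> {ffun D -> nat} -> R) :
  (forall s (u : {ffun D -> nat}), u s = 0%N -> c s u = 0) ->
  g 0 = h 0 ->
  (forall s (v : {ffun D -> nat}), ((v s)%:R)%:E * g v =
     \esum_(u in [set u | vle u v]) ((c s u)%:E * g (vsub v u)))%E ->
  (forall s (v : {ffun D -> nat}), ((v s)%:R)%:E * h v =
     \esum_(u in [set u | vle u v]) ((c s u)%:E * h (vsub v u)))%E ->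
  g =1 h.
Proof.
move=> c0 gh0 gE hE v.
have [n] := ubnP (\sum_s v s)%N; elim: n v => // n IH v /ltnSE vn.
have [->//|vN0] := eqVneq v 0.
have [s vs] : exists s, v s != 0%N.
  apply/existsP; apply: contraNT vN0 => /existsPn v0.
  by apply/eqP/ffunP => s; rewrite ffunE; have := v0 s; rewrite negbK => /eqP.
have vsN0 : (v s)%:R != 0 :> R by rewrite pnatr_eq0.
suff e : (((v s)%:R)%:E * g v = ((v s)%:R)%:E * h v)%E.
  have {}e := congr1 (fun x => (((v s)%:R)^-1)%:E * x)%E e.
  by move: e; rewrite !muleA -EFinM mulVf// !mul1e.
rewrite gE hE; apply: eq_esum => u /= /vleP uv.
have [/c0 ->|us] := eqVneq (u s) 0%N; first by rewrite !mul0e.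
rewrite IH//; apply: leq_trans vn; rewrite (bigD1 s)//= [X in (_ < X)%N](bigD1 s)//=.
rewrite -addSn leq_add//; last by apply: leq_sum => r _; rewrite ffunE leq_subr.
by rewrite ffunE ltn_subrL !lt0n us.
Qed.

(** * Independent families of discrete random variables *)

Lemma sigma_algebra_countable_preimage {T : Type} (F : set (set T)) {C : countType}
    (Z : T -> C) (B : set C) : sigma_algebra setT F ->
  (forall c, F [set w | Z w = c]) -> F [set w | B (Z w)].
Proof.
move=> [F0 _ FU] FZ.
rewrite (_ : [set w | _] = \bigcup_n
  (if pickle_inv n is Some c then if c \in B then [set w | Z w = c] else set0
   else set0)).
  by apply: FU => n; case: pickle_inv => // c; case: ifP.
apply/seteqP; split => [w Bw|w [n _]] /=.
  by exists (choice.pickle (Z w)) => //; rewrite pickleK_inv mem_set.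
by case: pickle_inv => // c; case: ifPn => // /set_mem Bc /= ->.
Qed.

Section discrete.
Context {d} {T : measurableType d} {R : realType} (P : probability T R).
Local Open Scope ereal_scope.

Lemma measurable_countable_preimage {C : countType} (Z : T -> C) (B : set C) :
  (forall c, measurable [set w | Z w = c]) -> measurable [set w | B (Z w)].
Proof.
apply: sigma_algebra_countable_preimage; split=> //.
  by move=> A mA; exact: measurableD.
by move=> A mA; exact: bigcup_measurable.
Qed.

(** Meant for events with a random index: where Z fixes the index, the event reads finitely many
    variables. *)
Lemma measurable_setI_countable {C : countType} (Z : T -> C) (F : set T) :
  (forall c, measurable (F `&` [set w | Z w = c])) -> measurable F.
Proof.
move=> mF; rewrite (_ : F = \bigcup_n
    (if pickle_inv n is Some c then F `&` [set w | Z w = c] else set0)).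
  by apply: bigcup_measurable => n _; case: pickle_inv.
apply/seteqP; split => [w Fw|w [n _]]; last by case: pickle_inv => // c [].
by exists (choice.pickle (Z w)) => //; rewrite pickleK_inv.
Qed.

Lemma esum_probability {C : countType} (Z : T -> C) (E : set T) :
  measurable E -> (forall c, measurable [set w | Z w = c]) ->
  P E = \esum_(c in [set: C]) P (E `&` [set w | Z w = c]).
Proof.
move=> mE mZ; pose F n := E `&` [set w | choice.pickle (Z w) = n].
have mF n : measurable (F n).
  apply: measurableI => //.
  exact: (measurable_countable_preimage [set c | choice.pickle c = n] mZ).
have -> : P E = P (\bigcup_n F n).
  congr (P _); apply/seteqP; split=> [w Ew|w [n _ []]//].
  by exists (choice.pickle (Z w)).
rewrite measure_bigcup//; last by move=> i j _ _ [w [[_ <-] [_ <-]]].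
rewrite nneseries_esum// (_ : [set x | _] = setT); last first.
  by apply/seteqP; split=> // n _; exact: in_setT.
rewrite (esumID (range (@choice.pickle C))) ?setTI//.
rewrite [X in _ + X]esum1 ?adde0; last first.
  move=> n nC; rewrite (_ : F n = set0) ?measure0//.
  by apply/seteqP; split=> // w [_ Zn]; apply: nC; exists (Z w).
rewrite esum_image; last by move=> x y _ _; exact: (pcan_inj choice.pickleK).
apply: eq_esum => c _; congr (P (_ `&` _)); apply/seteqP; split=> w /=.
  exact: (pcan_inj choice.pickleK).
by move=> ->.
Qed.

Lemma probability_fineK (E : set T) : measurable E -> (fine (P E))%:E = P E.
Proof. by move=> mE; rewrite fineK// fin_num_measure. Qed.

(** The point is that q does not depend on c. It is the probability of an event in independence
    statements, and a compound Poisson mass when F sums jumps from a random index on. *)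
Lemma probability_mul {C : countType} (Z : T -> C) (E F : set T) (q : \bar R) :
  measurable E -> measurable F -> (forall c, measurable [set w | Z w = c]) ->
  q \is a fin_num -> 0 <= q ->
  (forall c, P (E `&` [set w | Z w = c] `&` F) =
     P (E `&` [set w | Z w = c]) * q) ->
  P (E `&` F) = P E * q.
Proof.
move=> mE mF mZ fq q0 EZF.
rewrite (esum_probability (measurableI _ _ mE mF) mZ) (esum_probability mE mZ).
rewrite -(fineK fq) muleC -ge0_esumZl//; last exact: fine_ge0.
by apply: eq_esum => c _; rewrite setIAC EZF fineK// muleC.
Qed.

End discrete.

(** * Independence of events that read disjoint lists of variables *)

Section independent_family.
Context {d} {T : measurableType d} {R : realType} (P : probability T R).
Context {C : countType} {I : choiceType} (Y : I -> T -> C).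
Hypothesis mY : forall i c, measurable [set w | Y i w = c].
Hypothesis Y_indep : mutual_indep P
  (fun i => range (fun B : set C => [set w | B (Y i w)])).
Local Open Scope ereal_scope.

(** Stands for membership in the sigma-algebra generated by the listed variables: as these are
    countable-valued and finitely many, such an E is a countable union of cylinders. *)
Definition depends_on (L : seq I) (E : set T) :=
  forall w w', {in L, forall i, Y i w = Y i w'} -> E w -> E w'.

Let YL (L : seq I) (w : T) : seq C := [seq Y i w | i <- L].

Let mYL L z : measurable [set w | YL L w = z].
Proof.
elim: L z => [|i L IH] [|c z] /=.
- by rewrite (_ : [set w | _] = setT)//; apply/seteqP; split.
- by rewrite (_ : [set w | _] = set0)//; apply/seteqP; split.
- by rewrite (_ : [set w | _] = set0)//; apply/seteqP; split.
- rewrite (_ : [set w | _] = [set w | Y i w = c] `&` [set w | YL L w = z]).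
    exact: measurableI.
  by apply/seteqP; split => [w /= [-> ->] //|w /= [-> ->]].
Qed.

Let YL_eq L w w' : YL L w = YL L w' <-> {in L, forall i, Y i w = Y i w'}.
Proof. by split => /eq_in_map. Qed.

Lemma measurable_depends L E : depends_on L E -> measurable E.
Proof.
move=> dE; rewrite (_ : E = [set w | [set z | exists2 w', E w' & YL L w' = z] (YL L w)]).
  exact: measurable_countable_preimage.
apply/seteqP; split => [w Ew|w [w' Ew' /YL_eq h]]; first by exists w.
exact: dE Ew'.
Qed.

Lemma probability_cylinder (L : seq I) (y : I -> C) :
  P [set w | {in L, forall i, Y i w = y i}] =
  \prod_(i <- undup L) P [set w | Y i w = y i].
Proof.
have := Y_indep (J := [fset i in L]%fset) (E := fun i => [set w | Y i w = y i]).
have -> : \bigcap_(i in [set` [fset i in L]%fset]) [set w | Y i w = y i] =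
  [set w | {in L, forall i, Y i w = y i}].
  apply/seteqP; split => w /= h i; first by move=> iL; apply: h; rewrite /= !inE.
  by rewrite /= !inE => /h.
move=> -> => [|i _]; last by exists [set y i].
apply: perm_big; apply: uniq_perm; rewrite ?undup_uniq ?fset_uniq// => i.
by rewrite !inE mem_undup.
Qed.

(** Cut E and F along the values of their lists. Each nonempty piece is a whole cylinder, and for
    cylinders over disjoint lists the product rule is the independence of the family. *)
Lemma depends_indep L1 L2 E F : {in L1, forall i, i \notin L2} ->
  depends_on L1 E -> depends_on L2 F -> P (E `&` F) = P E * P F.
Proof.
move=> L12 dE dF.
have mE := measurable_depends dE; have mF := measurable_depends dF.
have atom L G c w : depends_on L G -> G w -> YL L w = c ->
    G `&` [set w | YL L w = c] = [set w' | {in L, forall i, Y i w' = Y i w}].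
  move=> dG Gw <-; apply/seteqP; split => [w' [_ /YL_eq//]|w' h].
  by split; [apply: dG Gw => i iL; rewrite h|apply/YL_eq].
apply: (probability_mul (Z := YL L1)) => // [|c]; first exact: fin_num_measure.
have [->|/set0P[w [Ew Zw]]] := eqVneq (E `&` [set w | YL L1 w = c]) set0.
  by rewrite set0I measure0 mul0e.
rewrite (atom _ _ _ w)// setIC muleC.
have mA : measurable [set w' | {in L1, forall i, Y i w' = Y i w}].
  by rewrite -(atom _ _ _ _ dE Ew Zw); exact: measurableI.
apply: (probability_mul (Z := YL L2)) => // [|c']; first exact: fin_num_measure.
have [->|/set0P[w' [Fw' Zw']]] := eqVneq (F `&` [set w | YL L2 w = c']) set0.
  by rewrite set0I measure0 mul0e.
rewrite (atom _ _ _ w')// setIC muleC.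
(* Since the lists are disjoint, one assignment agrees with w on [L1] and with w' on [L2]; the two
   cylinders then merge into one over [L1 ++ L2]. *)
pose y i := if i \in L1 then Y i w else Y i w'.
have y1 i : i \in L1 -> y i = Y i w by rewrite /y => ->.
have y2 i : i \in L2 -> y i = Y i w'.
  by rewrite /y; case: ifP => // /L12; case: (i \in L2).
have -> : [set w'0 | {in L1, forall i, Y i w'0 = Y i w}] =
    [set w'0 | {in L1, forall i, Y i w'0 = y i}].
  by apply/seteqP; split => v /= h i iL; rewrite h ?y1.
have -> : [set w'0 | {in L2, forall i, Y i w'0 = Y i w'}] =
    [set w'0 | {in L2, forall i, Y i w'0 = y i}].
  by apply/seteqP; split => v /= h i iL; rewrite h ?y2.
rewrite !probability_cylinder -big_cat /=.
have -> : [set w'0 | {in L1, forall i, Y i w'0 = y i}] `&`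
    [set w'0 | {in L2, forall i, Y i w'0 = y i}] =
    [set w'0 | {in L1 ++ L2, forall i, Y i w'0 = y i}].
  apply/seteqP; split => v /=.
    by move=> [h k] i; rewrite mem_cat => /orP[/h|/k].
  by move=> h; split=> i iL; apply: h; rewrite mem_cat iL ?orbT.
rewrite probability_cylinder; apply: perm_big; apply: uniq_perm.
- exact: undup_uniq.
- rewrite cat_uniq !undup_uniq /= andbT; apply/hasPn => i.
  by rewrite !mem_undup; apply: contraL => /L12.
- by move=> i; rewrite !(mem_cat, mem_undup).
Qed.

End independent_family.

(** * Sums of a random number of independent jumps *)

Section compound_sums.
Context {d} {T : measurableType d} {R : realType} (P : probability T R).
Context {C : countType} {I : choiceType} (Y : I -> T -> C).
Hypothesis mY : forall i c, measurable [set w | Y i w = c].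
Hypothesis Y_indep : mutual_indep P
  (fun i => range (fun B : set C => [set w | B (Y i w)])).
Context {D : finType} (val : C -> {ffun D -> nat}) (mu : {ffun D -> nat} -> R).
Local Open Scope ereal_scope.

Let mval i v : measurable [set w | val (Y i w) = v].
Proof. exact: (measurable_countable_preimage [set c | val c = v] (mY i)). Qed.

Lemma law_ge0 i : (forall u, P [set w | val (Y i w) = u] = (mu u)%:E) ->
  forall u, (0 <= mu u)%R.
Proof. by move=> h u; rewrite -lee_fin -h. Qed.

Lemma esum_law i : (forall u, P [set w | val (Y i w) = u] = (mu u)%:E) ->
  \esum_(u in [set: {ffun D -> nat}]) (mu u)%:E = 1.
Proof.
move=> h; rewrite -(probability_setT P) (esum_probability P measurableT (mval i)).
by apply: eq_esum => u _; rewrite setTI.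
Qed.

Lemma measurable_sum_eq (iota : nat -> I) m v :
  measurable [set w | (\sum_(i < m) val (Y (iota i) w))%R = v].
Proof.
apply: (measurable_depends (Y := Y) mY (L := [seq iota i | i <- index_iota 0 m])).
move=> w w' h /= <-; apply: eq_bigr => i _; rewrite h//.
by apply: map_f; rewrite mem_index_iota /=.
Qed.

(** Injectivity makes the first summand independent of the others; splitting on its value reproduces
    the recursion defining [conv_pow]. *)
Lemma probability_sum_eq (iota : nat -> I) m v : injective iota ->
  (forall i u, P [set w | val (Y (iota i) w) = u] = (mu u)%:E) ->
  P [set w | (\sum_(i < m) val (Y (iota i) w))%R = v] = conv_pow mu m v.
Proof.
move=> + h; have mu0 := law_ge0 (h 0%N).
elim: m iota v h => [|m IH] iota v h iotaI.
  rewrite /=; case: (v =P 0%R) => [->|/eqP v0].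
    rewrite (_ : [set _ | _] = setT) ?probability_setT//.
    by apply/seteqP; split=> // w _ /=; rewrite big_ord0.
  rewrite (_ : [set _ | _] = set0) ?measure0//.
  by apply/seteqP; split=> // w /= /esym/eqP; rewrite big_ord0 (negbTE v0).
rewrite [conv_pow _ _ _]/= esum_mkcond.
rewrite (esum_probability P (measurable_sum_eq iota m.+1 v) (mval (iota 0%N))).
apply: eq_esum => u _.
have sumE w : (\sum_(i < m.+1) val (Y (iota i) w))%R =
    (val (Y (iota 0%N) w) + \sum_(i < m) val (Y (iota i.+1) w))%R.
  by rewrite big_ord_recl.
case: ifPn => [/set_mem/= uv|uv]; last first.
  rewrite (_ : _ `&` _ = set0) ?measure0//; apply/seteqP; split=> // w /=.
  rewrite sumE => -[/eqP]; rewrite vaddE => /andP[h' _] e; apply/negP: uv.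
  by rewrite negbK mem_set//= -e.
rewrite (_ : _ `&` _ = [set w | val (Y (iota 0%N) w) = u] `&`
    [set w | (\sum_(i < m) val (Y (iota i.+1) w))%R = vsub v u]); last first.
  apply/seteqP; split=> w /=; rewrite sumE.
    by move=> [+ uE]; rewrite uE => /eqP; rewrite vaddE => /andP[_ /eqP].
  move=> [-> e]; split=> //; apply/eqP; rewrite vaddE uv/=; exact/eqP.
rewrite (depends_indep mY Y_indep (L1 := [:: iota 0%N])
  (L2 := [seq iota i.+1 | i <- index_iota 0 m])).
- by rewrite h (IH (fun i => iota i.+1))// => i j /iotaI[].
- by move=> i; rewrite inE => /eqP ->; apply/mapP => -[j _ /iotaI].
- by move=> w w' e /= <-; rewrite e// inE.
- move=> w w' e /= <-; apply: eq_bigr => i _; rewrite e//.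
  by apply: (map_f (fun i => iota i.+1)); rewrite mem_index_iota /=.
Qed.

(* Conditionally on Z = c, the event E only involves the variables listed in
   L c, while the new block is a sum of fresh summands, with index at least n c. *)
Lemma probability_compound_step (th : R) (cnt : C -> nat) (q : I)
    {C' : countType} (Z : T -> C') (n : C' -> nat) (E : set T)
    (idx : nat -> I) (L : C' -> seq I) (v : {ffun D -> nat}) :
  (0 < th)%R ->
  (forall k, P [set w | cnt (Y q w) = k] = (poisson_pmf th k)%:E) ->
  (forall i u, P [set w | val (Y (idx i) w) = u] = (mu u)%:E) ->
  injective idx -> (forall i, idx i != q) ->
  measurable E -> (forall c, measurable [set w | Z w = c]) ->
  (forall c, depends_on Y (L c) (E `&` [set w | Z w = c])) ->
  (forall c, q \notin L c) ->
  (forall c i, (n c <= i)%N -> idx i \notin L c) ->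
  P (E `&` [set w | (\sum_(i < cnt (Y q w)) val (Y (idx (n (Z w) + i)%N) w))%R = v]) =
  P E * compound_poisson mu th v.
Proof.
move=> th0 lawq lawU idxI idxq mE mZ dE qL idxL.
have mu0 := law_ge0 (lawU 0%N); have mu1 := esum_law (lawU 0%N).
have cp0 := conv_pow_ge0 mu0.
have mcnt k : measurable [set w | cnt (Y q w) = k].
  exact: (measurable_countable_preimage [set c | cnt c = k] (mY q)).
set F := [set w | _ = v].
pose S c k := [set w | (\sum_(i < k) val (Y (idx (n c + i)%N) w))%R = v].
have mS c k : measurable (S c k).
  exact: (measurable_sum_eq (fun i => idx (n c + i)%N)).
have mF : measurable F.
  apply: (measurable_setI_countable (Z := fun w => (Z w, cnt (Y q w)))) => -[c k].
  rewrite (_ : _ `&` _ = S c k `&` ([set w | Z w = c] `&` [set w | cnt (Y q w) = k])).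
    by apply: measurableI => //; exact: measurableI.
  by apply/seteqP; split => w; rewrite /F/S/= => -[h [e1 e2]]; move: h; rewrite e1 e2.
(* Given Z = c, the block starts at the fixed index [n c]. Splitting further on the count gives the
   Poisson mixture of convolution powers, which is the same for every c. *)
apply: (probability_mul (Z := Z)) => //.
- by apply: compound_poisson_fin_num => //; rewrite mu1.
- exact: compound_poisson_ge0.
move=> c; rewrite (esum_probability P _ mcnt); last first.
  by apply: measurableI => //; exact: measurableI.
rewrite -(probability_fineK P (measurableI _ _ mE (mZ c))).
rewrite /compound_poisson -ge0_esumZl ?fine_ge0//; last first.
  by move=> k; exact: poisson_conv_ge0.
rewrite (probability_fineK P (measurableI _ _ mE (mZ c))).
apply: eq_esum => k _.
have -> : E `&` [set w | Z w = c] `&` F `&` [set w | cnt (Y q w) = k] =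
    (E `&` [set w | Z w = c]) `&` ([set w | cnt (Y q w) = k] `&` S c k).
  by apply/seteqP; split => w; rewrite /F/S/=;
    [move=> [[[? e1] h] e2]|move=> [[? e1] [e2 h]]]; move: h; rewrite e1 e2.
have dS : depends_on Y [seq idx (n c + i)%N | i <- index_iota 0 k] (S c k).
  move=> w w' e; rewrite /S/= => <-; apply: eq_bigr => i _; rewrite e//.
  by apply: (map_f (fun i => idx (n c + i)%N)); rewrite mem_index_iota /=.
have dq : depends_on Y [:: q] [set w | cnt (Y q w) = k].
  by move=> w w' e /= <-; rewrite e// inE.
rewrite (depends_indep mY Y_indep
  (L2 := q :: [seq idx (n c + i)%N | i <- index_iota 0 k]) _ (dE c)); last first.
- move=> w w' e [h1 h2]; split.
    by apply: dq h1 => i; rewrite inE => /eqP ->; apply: e; rewrite inE eqxx.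
  by apply: dS h2 => i ik; apply: e; rewrite inE ik orbT.
- move=> i iL; rewrite inE negb_or; apply/andP; split.
    by apply: contraTneq iL => ->; exact: qL.
  by apply/mapP => -[j _ ij]; move: iL; apply/negP; rewrite ij idxL// leq_addr.
rewrite (depends_indep mY Y_indep _ dq dS); last first.
  move=> i; rewrite inE => /eqP ->; apply/mapP => -[j _ /esym/eqP].
  by apply/negP; exact: idxq.
rewrite lawq (probability_sum_eq (iota := fun i => idx (n c + i)%N))//.
by move=> i j /idxI /addnI.
Qed.

End compound_sums.

(** * Merging independent families into one *)

Section independence.
Context {d} {T : measurableType d} {R : realType} (P : probability T R).

Lemma sub_mutual_indep {I : choiceType} (F G : I -> set (set T)) :
  (forall i, F i `<=` G i) -> mutual_indep P G -> mutual_indep P F.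
Proof. by move=> FG Gind J E FE; apply: Gind => i iJ; exact/FG/FE. Qed.

Lemma sigma_algebra_bigcap_fset {I : choiceType} (F : set (set T))
    (J : {fset I}) (E : I -> set T) : sigma_algebra setT F ->
  (forall i, i \in J -> F (E i)) -> F (\bigcap_(i in [set` J]) E i).
Proof.
move=> /sigma_algebraP[//|FT _ _ FI] FE.
rewrite bigcap_fset big_seq; apply: big_ind => //.
Qed.

(** Puts increments and jumps into a single independent family. [F'] and [G'] are sigma-algebras so
    that the finite intersections from each side stay inside them and [indep] applies. *)
Lemma mutual_indep_sum {I J : choiceType} (F : I -> set (set T))
    (G : J -> set (set T)) (F' G' : set (set T)) :
  sigma_algebra setT F' -> sigma_algebra setT G' ->
  (forall i, F i `<=` F') -> (forall j, G j `<=` G') -> indep P F' G' ->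
  mutual_indep P F -> mutual_indep P G ->
  mutual_indep P (fun x : I + J => match x with inl i => F i | inr j => G j end).
Proof.
move=> sF sG FF GG FG Find Gind K E KE.
pose K1 : {fset I} :=
  [fset i in pmap (fun x : I + J => if x is inl i then Some i else None) K]%fset.
pose K2 : {fset J} :=
  [fset j in pmap (fun x : I + J => if x is inr j then Some j else None) K]%fset.
have K1E i : (i \in K1) = (inl i \in K).
  rewrite !inE mem_pmap; apply/mapP/idP => [[[j|//] + [->]] //|iK].
  by exists (inl i).
have K2E i : (i \in K2) = (inr i \in K).
  rewrite !inE mem_pmap; apply/mapP/idP => [[[//|j] + [->]] //|iK].
  by exists (inr i).
have permK : perm_eq K ([seq inl i | i <- K1] ++ [seq inr j | j <- K2]).
  apply: uniq_perm; rewrite ?fset_uniq//.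
    rewrite cat_uniq !map_inj_uniq ?fset_uniq ?andbT/= => [|i j []//|i j []//].
    by apply/hasPn => x /mapP[j _ ->]; apply/mapP => -[].
  move=> [i|j]; rewrite mem_cat -?K1E -?K2E.
    rewrite (mem_map (f := inl)) => [|? ? []//].
    by rewrite orbC; case: mapP => // -[].
  rewrite (mem_map (f := inr)) => [|? ? []//].
  by case: mapP => // -[].
rewrite (perm_big _ permK)/= big_cat !big_map/=.
rewrite -(Find K1 (E \o inl)) => [|i]; last by rewrite K1E => /KE.
rewrite -(Gind K2 (E \o inr)) => [|i]; last by rewrite K2E => /KE.
rewrite -FG.
- congr (P _); apply/seteqP; split => w h.
    by split=> x /=; rewrite ?K1E ?K2E => /h.
  by case: h => h1 h2 [i|j] /= xK; [apply: h1|apply: h2]; rewrite /= ?K1E ?K2E.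
- by apply: sigma_algebra_bigcap_fset => // i; rewrite K1E => /KE /FF.
- by apply: sigma_algebra_bigcap_fset => // i; rewrite K2E => /KE /GG.
Qed.

(** Group a finite set of pairs by first component: the product rule holds between the groups, then
    within each. This handles increments of several processes and coordinates of several jumps. *)
Lemma mutual_indep_nested {I J : choiceType} (F : I -> set (set T))
    (G : I -> J -> set (set T)) :
  (forall i, sigma_algebra setT (F i)) -> (forall i j, G i j `<=` F i) ->
  mutual_indep P F -> (forall i, mutual_indep P (G i)) ->
  mutual_indep P (fun x : I * J => G x.1 x.2).
Proof.
move=> sF GF Find Gind K E KE.
pose K1 : {fset I} := [fset i in [seq x.1 | x <- K]]%fset.
pose K2 i : {fset J} := [fset j in [seq x.2 | x <- K & x.1 == i]]%fset.
have K2E i j : (j \in K2 i) = ((i, j) \in K).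
  rewrite !inE; apply/mapP/idP => [[[i' j'] + ->]|ijK].
    by rewrite mem_filter => /andP[/eqP/= ->].
  by exists (i, j); rewrite // mem_filter/= eqxx.
have K1P i j : (i, j) \in K -> i \in K1.
  by move=> ijK; rewrite !inE; apply/mapP; exists (i, j).
have permK : perm_eq K [seq (i, j) | i <- K1, j <- K2 i].
  apply: uniq_perm; rewrite ?fset_uniq//.
    apply: allpairs_uniq_dep => [|i _|]; do ?exact: fset_uniq.
    by move=> [i j] [i' j'] _ _ /= [-> ->].
  move=> [i j]; apply/idP/allpairsPdep => [ijK|[i' [j' [_ + [-> ->]]]]].
    by exists i, j; rewrite (K1P _ _ ijK) K2E.
  by rewrite K2E.
rewrite (perm_big _ permK)/= big_allpairs_dep/=.
under eq_bigr => i _.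
  rewrite -(Gind i (K2 i) (fun j => E (i, j))) => [|j]; last by rewrite K2E => /KE.
  over.
rewrite -(Find K1 (fun i => \bigcap_(j in [set` K2 i]) E (i, j))) => [|i _].
  congr (P _); apply/seteqP; split => w h.
    by move=> i _ j /=; rewrite K2E => /h.
  by move=> [i j] /= ijK; apply: (h i) => /=; rewrite ?K2E// (K1P _ _ ijK).
by apply: sigma_algebra_bigcap_fset => // j; rewrite K2E => /KE; exact: GF.
Qed.

Lemma sigma_algebra_sigma_of {dE} {E : measurableType dE} {I : Type}
    (X : I -> T -> E) : sigma_algebra setT (sigma_of X).
Proof. exact: smallest_sigma_algebra. Qed.

Lemma sigma_of_preimage {dE} {E : measurableType dE} {I : Type}
    (X : I -> T -> E) i B : measurable B -> sigma_of X [set w | B (X i w)].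
Proof.
move=> mB; apply: sub_sigma_algebra; exists i => //.
by exists B => //; rewrite setTI.
Qed.

End independence.

Lemma measurable_countable_set {dE} {E : measurableType dE} {C : countType}
    (f : E -> C) (B : set E) : injective f ->
  (forall x, measurable [set x : E]) -> measurable B.
Proof.
move=> fI mE; rewrite (_ : B = [set x | [set c | exists2 y, B y & f y = c] (f x)]).
  apply: measurable_countable_preimage => c.
  have [[x fx]|nx] := pselect (exists x, f x = c); last first.
    by rewrite (_ : [set w | _] = set0)//; apply/seteqP; split=> // x fx; apply: nx; exists x.
  rewrite (_ : [set w | _] = [set x])//.
  by apply/seteqP; split => y /=; rewrite -fx; [exact: fI|move=> ->].
by apply/seteqP; split => [x Bx|x [y By /fI <-]]//; exists x.
Qed.

Lemma measurable_nat_tuple (n : nat) (B : set (n.-tuple nat)) : measurable B.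
Proof.
apply: (@measurable_countable_set _ _ (n.-tuple nat) id) => // u.
rewrite (_ : [set u] = \bigcap_(s in [set: 'I_n]) [set v | tnth v s = tnth u s]).
  apply: fin_bigcap_measurable => // s _.
  by have := @measurable_tnth _ nat n s measurableT [set tnth u s]; rewrite setTI; apply.
apply/seteqP; split => [v -> //|v h].
by apply: eq_from_tnth => s; exact: h.
Qed.

Lemma sigma_algebra_preimage_pair {T : Type} (F : set (set T)) {A B : countType}
    (f : T -> A) (g : T -> B) (S : set (A * B)) : sigma_algebra setT F ->
  (forall a, F [set w | f w = a]) -> (forall b, F [set w | g w = b]) ->
  F [set w | S (f w, g w)].
Proof.
move=> sF Ff Fg; apply: (sigma_algebra_countable_preimage _ sF) => -[a b].
rewrite (_ : [set w | _] = [set w | f w = a] `&` [set w | g w = b]).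
  by have /sigma_algebraP[//|_ _ _] := sF; apply.
by apply/seteqP; split => w /= [-> ->].
Qed.

(** * Paths of the two compound processes *)

Section poisson_increments.
Context {d} {T : measurableType d} {R : realType} (P : probability T R).
Variables (th : R) (N : {nonneg R} -> {RV P >-> nat}).
Hypothesis N_poisson : poisson_process th N.

Lemma measurable_RV_nat (X : {RV P >-> nat}) k : measurable [set w | X w = k].
Proof.
by rewrite -[X in measurable X]setTI; exact: (measurable_funPT X measurableT [set k]).
Qed.

Lemma measurable_increment s t k : measurable [set w | increment N s t w = k].
Proof.
apply: (sigma_algebra_preimage_pair (f := N t) (g := N s)
  [set ab | (ab.1 - ab.2)%N = k]); [|exact: measurable_RV_nat..].
exact: sigma_algebra_measurable.
Qed.

Lemma sigma_of_increment s t B : sigma_of N [set w | B (increment N s t w)].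
Proof.
apply: (sigma_algebra_preimage_pair (f := N t) (g := N s)
  [set ab | B (ab.1 - ab.2)%N]); first exact: sigma_algebra_sigma_of.
  by move=> a; apply: (@sigma_of_preimage _ _ _ _ _ _ t [set a]).
by move=> a; apply: (@sigma_of_preimage _ _ _ _ _ _ s [set a]).
Qed.

Variable tau : nat -> {nonneg R}.
Hypothesis tau_mono : nondecreasing_seq tau.

Lemma mutual_indep_increments : mutual_indep P
  (fun k => range (fun B : set nat => [set w | B (increment N (tau k) (tau k.+1) w)])).
Proof.
case: N_poisson => _ /(_ _ tau_mono) + _; apply: sub_mutual_indep => k _ [B _ <-].
exact: (@sigma_of_preimage _ _ _ _ _ _ tt B).
Qed.

(** Monotone paths make the truncated subtraction in [increment] exact. *)
Lemma counting_increment s t w : s <= t -> (N s w + increment N s t w)%N = N t w.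
Proof. by case: N_poisson => /(_ w)[_ h _] _ _ st; rewrite /increment subnKC// h. Qed.

Lemma counting_sum_increments k w : tau 0%N = 0%:nng ->
  N (tau k) w = (\sum_(j < k) increment N (tau j) (tau j.+1) w)%N.
Proof.
move=> tau0; elim: k => [|k IH].
  by rewrite big_ord0 tau0; case: N_poisson => /(_ w)[].
by rewrite big_ord_recr/= -IH counting_increment//; exact: tau_mono.
Qed.

End poisson_increments.

(** Finite functions carry the pointwise addition and the zero used in sums of jumps. *)
Definition vec {n} (u : n.-tuple nat) : {ffun 'I_n -> nat} := [ffun s => tnth u s].

Lemma vec_inj n : injective (@vec n).
Proof. by move=> u v /ffunP h; apply: eq_from_tnth => s; move: (h s); rewrite !ffunE. Qed.

Lemma tnth_compound_process {R : realType} {T : Type} {d : nat}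
    (N : 'I_d -> {nonneg R} -> T -> nat) (U : nat -> T -> d.-tuple nat) t w s :
  tnth (compound_process N U t w) s = (\sum_(i < N s t w) tnth (U i w) s)%N.
Proof.
rewrite tnth_mktuple; case: (N s t w) => [|n]; first by rewrite big_ord0.
by rewrite ltn0Sn mul1n.
Qed.

Lemma sum_ord_addn {V : nmodType} (m n : nat) (F : nat -> V) :
  \sum_(i < m + n) F i = \sum_(i < m) F i + \sum_(i < n) F (m + i)%N.
Proof. by rewrite big_split_ord. Qed.

Definition path_event {T V : Type} (X : nat -> T -> V) (x : nat -> V) (K : nat) :
  set T := [set w | forall k, (k <= K)%N -> X k w = x k].

Lemma path_eventS {T V : Type} (X : nat -> T -> V) (x : nat -> V) (K : nat) :
  path_event X x K.+1 = path_event X x K `&` [set w | X K.+1 w = x K.+1].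
Proof.
apply/seteqP; split => [w h|w [h hK] k].
  by split; [move=> k kK; apply: h; exact: leqW|exact: h].
by rewrite leq_eqVlt => /orP[/eqP -> //|/ltnSE]; exact: h.
Qed.

(** * The first process: one count drives all coordinates *)

Section vector_compound.
Context {R : realType} {d : nat} {dT} {T : measurableType dT}.
Variables (P : probability T R) (U : nat -> {RV P >-> d.-tuple nat}).
Variables (th : R) (N : {nonneg R} -> {RV P >-> nat}).
Variables (mu : {ffun 'I_d -> nat} -> R) (tau : nat -> {nonneg R}).
Hypothesis th_gt0 : 0 < th.
Hypothesis N_poisson : poisson_process th N.
Hypothesis U_indep : mutual_indep P (fun i : nat => sigma_of (fun _ : unit => U i)).
Hypothesis N_U_indep : indep P (sigma_of N) (sigma_of U).
Hypothesis U_law : forall i u, P [set w | vec (U i w) = u] = (mu u)%:E.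
Hypothesis tau_mono : nondecreasing_seq tau.
Hypothesis tau0 : tau 0%N = 0%:nng.

Let Y (x : nat + nat) (w : T) : (nat + {ffun 'I_d -> nat})%type :=
  match x with
  | inl k => inl (increment N (tau k) (tau k.+1) w)
  | inr i => inr (vec (U i w))
  end.

Lemma measurable_RV_tuple (X : {RV P >-> d.-tuple nat}) B :
  measurable [set w | B (X w)].
Proof.
rewrite -[X in measurable X]setTI; apply: (measurable_funPT X measurableT B).
exact: measurable_nat_tuple.
Qed.

Let mY i c : measurable [set w | Y i w = c].
Proof.
case: i c => [k|i] [n|u] /=.
- rewrite (_ : [set w | _] = [set w | increment N (tau k) (tau k.+1) w = n]).
    exact: measurable_increment.
  by apply/seteqP; split => w /= [->].
- by rewrite (_ : [set w | _] = set0)//; apply/seteqP; split.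
- by rewrite (_ : [set w | _] = set0)//; apply/seteqP; split.
- rewrite (_ : [set w | _] = [set w | vec (U i w) = u]).
    exact: (measurable_RV_tuple (U i) [set v | vec v = u]).
  by apply/seteqP; split => w /= [->].
Qed.

Let Y_indep : mutual_indep P (fun i => range (fun B : set _ => [set w | B (Y i w)])).
Proof.
have := mutual_indep_sum (sigma_algebra_sigma_of N) (sigma_algebra_sigma_of U) _ _
  N_U_indep (mutual_indep_increments N_poisson tau_mono) U_indep.
move=> h; apply: sub_mutual_indep (h _ _) => [[k|i] _ [B _ <-]|k _ [B _ <-]|i A].
- by exists (B \o inl).
- by apply: (@sigma_of_preimage _ _ _ _ _ _ tt (B \o inr \o vec));
    exact: measurable_nat_tuple.
- exact: sigma_of_increment.
- apply: sub_smallest2r; first exact: smallest_sigma_algebra.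
  by move=> {}A [_ _ [B mB <-]]; exists i => //; exists B.
Qed.

Let X k w := vec (compound_process (fun _ : 'I_d => N) U (tau k) w).

Let XE k w : X k w = \sum_(i < N (tau k) w) vec (U i w).
Proof.
apply/ffunP => s; rewrite ffunE tnth_compound_process sum_ffunE.
by apply: eq_bigr => i _; rewrite ffunE.
Qed.

Let mN k n : measurable [set w | N (tau k) w = n].
Proof. exact: measurable_RV_nat. Qed.

Let NE (K k : nat) (w w' : T) : (k <= K)%N ->
  {in [seq inl j | j <- index_iota 0 K], forall i, Y i w = Y i w'} ->
  N (tau k) w = N (tau k) w'.
Proof.
move=> kK e; rewrite !(counting_sum_increments N_poisson tau_mono)//.
apply: eq_bigr => j _; suff [] : Y (inl (j : nat)) w = Y (inl (j : nat)) w' by [].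
by apply: e; apply: map_f; rewrite mem_index_iota /= (leq_trans (ltn_ord j)).
Qed.

(** The count is monotone: if it equals c at [tau K], no earlier time involves a jump of index c or
    more. *)
Let dependsE K x c : depends_on Y
  ([seq inl j | j <- index_iota 0 K] ++ [seq inr i | i <- index_iota 0 c])
  (path_event X x K `&` [set w | N (tau K) w = c]).
Proof.
move=> w w' e [h Nc].
have e1 k : (k <= K)%N -> N (tau k) w = N (tau k) w'.
  by move=> kK; apply: (NE kK) => i iK; apply: e; rewrite mem_cat iK.
split; last by rewrite /= -e1.
move=> k kK; rewrite -h// !XE -e1//; apply: eq_bigr => i _.
suff [] : Y (inr (i : nat)) w = Y (inr (i : nat)) w' by [].
apply: e; rewrite mem_cat map_f ?orbT// mem_index_iota /= -Nc.
by apply: leq_trans (ltn_ord i) _; case: N_poisson => /(_ w)[_ + _] _ _; apply; exact: tau_mono.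
Qed.

Lemma measurable_path_vector K x : measurable (path_event X x K).
Proof.
by apply: (measurable_setI_countable (Z := N (tau K))) => c;
  exact: (measurable_depends mY (@dependsE K x c)).
Qed.

Lemma probability_path_vectorS (K : nat) (x : nat -> {ffun 'I_d -> nat}) :
  tau K < tau K.+1 ->
  P (path_event X x K.+1) = (P (path_event X x K) *
    if vle (x K) (x K.+1) then compound_poisson mu
      (th * ((tau K.+1)%:num - (tau K)%:num)) (vsub (x K.+1) (x K)) else 0)%E.
Proof.
move=> tauK; rewrite path_eventS.
have XS w : X K.+1 w = X K w +
    \sum_(i < increment N (tau K) (tau K.+1) w) vec (U (N (tau K) w + i)%N w).
  by rewrite !XE -(sum_ord_addn _ _ (fun i => vec (U i w))) (counting_increment N_poisson)// ltW.
case: ifPn => [le|nle]; last first.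
  rewrite mule0 (_ : _ `&` _ = set0) ?measure0//; apply/seteqP; split => // w [h] /=.
  by rewrite XS (h K)// => /eqP; rewrite vaddE (negbTE nle).
(* The new block starts at the current count, hence [n := id]. The default values 0 in [cnt] and
   [val] are not reached: [inl K] carries an increment and [inr i] a jump. *)
rewrite -(probability_compound_step mY Y_indep (q := inl K) (Z := N (tau K))
  (n := id) (idx := inr) (cnt := fun c => if c is inl n then n else 0%N)
  (val := fun c => if c is inr u then u else 0)
  (L := fun c => [seq inl j | j <- index_iota 0 K] ++ [seq inr i | i <- index_iota 0 c])) //.
- congr (P _); apply/seteqP; split => w /= [h e]; split=> //.
    by move: e; rewrite XS (h K)// => /eqP; rewrite vaddE le => /eqP.
  by rewrite XS (h K)//; apply/eqP; rewrite vaddE le; exact/eqP.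
- by rewrite mulr_gt0// subr_gt0.
- by move=> k; case: N_poisson => _ _; exact.
- by move=> i j [].
- exact: measurable_path_vector.
- move=> c; rewrite mem_cat negb_or; apply/andP; split; last by apply/mapP => -[].
  by rewrite mem_map ?mem_index_iota ?ltnn//; move=> ? ? [].
- move=> c i ci; rewrite mem_cat negb_or; apply/andP; split; first by apply/mapP => -[].
  by rewrite mem_map ?mem_index_iota /= ?ltnNge ?ci//; move=> ? ? [].
Qed.

End vector_compound.

Definition axis {n} (s : 'I_n) (a : nat) : {ffun 'I_n -> nat} :=
  [ffun r => if r == s then a else 0%N].

Lemma axis_inj n (s : 'I_n) : injective (axis s).
Proof. by move=> a b /ffunP /(_ s); rewrite !ffunE eqxx. Qed.

Lemma axis_sum n (s : 'I_n) (m : nat) (F : nat -> nat) :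
  \sum_(i < m) axis s (F i) = axis s (\sum_(i < m) F i)%N.
Proof.
apply/ffunP => r; rewrite sum_ffunE !ffunE.
under eq_bigr do rewrite ffunE.
by case: eqP => // _; rewrite big1.
Qed.

Lemma sub_sigma_of {T : Type} {dE} {E : measurableType dE} {I J : Type}
    (X : I -> T -> E) (X' : J -> T -> E) (h : I -> J) :
  (forall i, X i = X' (h i)) -> sigma_of X `<=` sigma_of X'.
Proof.
move=> XE; apply: sub_smallest2r; first exact: smallest_sigma_algebra.
by move=> A [i _ [B mB <-]]; exists (h i) => //; exists B; rewrite ?XE.
Qed.

(** * The second process: each coordinate has its own count *)

Section coordinate_compound.
Context {R : realType} {d : nat} {dT} {T : measurableType dT}.
Variables (P : probability T R) (U : nat -> {RV P >-> d.-tuple nat}).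
Variables (lam : 'I_d -> R) (N : 'I_d -> {nonneg R} -> {RV P >-> nat}).
Variables (mu : 'I_d -> {ffun 'I_d -> nat} -> R) (tau : nat -> {nonneg R}).
Hypothesis lam_gt0 : forall s, 0 < lam s.
Hypothesis N_poisson : forall s, poisson_process (lam s) (N s).
Hypothesis N_indep : mutual_indep P (fun s : 'I_d => sigma_of (N s)).
Hypothesis U_indep : mutual_indep P (fun i : nat => sigma_of (fun _ : unit => U i)).
Hypothesis U_coord_indep : forall i : nat, mutual_indep P
  (fun s : 'I_d => sigma_of (fun (_ : unit) w => tnth (U i w) s)).
Hypothesis U_N_indep : indep P (sigma_of U)
  (sigma_of (fun (st : 'I_d * {nonneg R}) => N st.1 st.2)).
Hypothesis U_law : forall i s u,
  P [set w | axis s (tnth (U i w) s) = u] = (mu s u)%:E.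
Hypothesis tau_mono : nondecreasing_seq tau.
Hypothesis tau0 : tau 0%N = 0%:nng.

(** Jump vectors are split into coordinates, because the i-th jump may be used already in one
    coordinate and still be fresh in another. *)
Let Y (x : 'I_d * nat + nat * 'I_d) (w : T) : nat :=
  match x with
  | inl (s, k) => increment (N s) (tau k) (tau k.+1) w
  | inr (i, s) => tnth (U i w) s
  end.

Let mY i c : measurable [set w | Y i w = c].
Proof.
case: i => [[s k]|[i s]] /=; first exact: measurable_increment.
exact: (measurable_RV_tuple (U i) [set v | tnth v s = c]).
Qed.

Let Y_indep : mutual_indep P (fun i => range (fun B : set _ => [set w | B (Y i w)])).
Proof.
have indN := mutual_indep_nested (fun s => sigma_algebra_sigma_of (N s)) _ N_indep
  (fun s => mutual_indep_increments (N_poisson s) tau_mono).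
have indU := mutual_indep_nested
  (G := fun i s => range (fun B : set nat => [set w | B (tnth (U i w) s)]))
  (fun i => sigma_algebra_sigma_of (fun _ : unit => U i)) _ U_indep.
have NU_indep : indep P (sigma_of (fun (st : 'I_d * {nonneg R}) => N st.1 st.2))
    (sigma_of U).
  by move=> A B FA GB; rewrite setIC muleC; exact: U_N_indep.
have h := mutual_indep_sum (sigma_algebra_sigma_of _) (sigma_algebra_sigma_of U) _ _
  NU_indep (indN _) (indU _ _).
apply: sub_mutual_indep (h _ _ _ _ _) =>
  [[[s k]|[i s]] A|[s k] _ [B _ <-]|[i s] _ [B _ <-]|s k _ [B _ <-]
  |i s _ [B _ <-]|i] //.
- apply: (sub_sigma_of (X := N s) (h := fun t => (s, t))) => //.
  exact: sigma_of_increment.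
- apply: (@sigma_of_preimage _ _ _ _ _ _ i [set v | B (tnth v s)]).
  exact: measurable_nat_tuple.
- exact: sigma_of_increment.
- apply: (@sigma_of_preimage _ _ _ _ _ _ tt [set v | B (tnth v s)]).
  exact: measurable_nat_tuple.
- apply: (sub_mutual_indep _ (@U_coord_indep i)) => s _ [B _ <-].
  exact: (@sigma_of_preimage _ _ _ _ _ _ tt B).
Qed.

Let X k w := vec (compound_process N U (tau k) w).

Let XE k w s : X k w s = (\sum_(i < N s (tau k) w) tnth (U i w) s)%N.
Proof. by rewrite ffunE tnth_compound_process. Qed.

(* The coordinates are advanced one at a time: m s is the index of the last
   time already observed for the s-th coordinate. *)
Let coord_event (x : nat -> {ffun 'I_d -> nat}) (m : 'I_d -> nat) : set T :=
  [set w | forall s k, (k <= m s)%N -> X k w s = x k s].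

Let Z m w : {ffun 'I_d -> nat} := [ffun s => N s (tau (m s)) w].

Let mZ m c : measurable [set w | Z m w = c].
Proof.
rewrite (_ : [set w | _] = \bigcap_(s in [set: 'I_d]) [set w | N s (tau (m s)) w = c s]).
  by apply: fin_bigcap_measurable => // s _; exact: measurable_RV_nat.
apply/seteqP; split => [w <- s _|w h]; first by rewrite /= ffunE.
by apply/ffunP => s; rewrite ffunE; exact: h.
Qed.

Let L (m : 'I_d -> nat) (c : {ffun 'I_d -> nat}) : seq ('I_d * nat + nat * 'I_d) :=
  [seq inl (s, k) | s <- enum 'I_d, k <- index_iota 0 (m s)] ++
  [seq inr (i, s) | s <- enum 'I_d, i <- index_iota 0 (c s)].

Let inl_L m c s k : (inl (s, k) \in L m c) = (k < m s)%N.
Proof.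
rewrite mem_cat orbC; case: allpairsPdep => [[? [? [_ _ //]]]|_] /=.
apply/allpairsPdep/idP => [[s' [k' [_ + [-> ->]]]]|h]; first by rewrite mem_index_iota.
by exists s, k; rewrite mem_enum mem_index_iota.
Qed.

Let inr_L m c s i : (inr (i, s) \in L m c) = (i < c s)%N.
Proof.
rewrite mem_cat; case: allpairsPdep => [[? [? [_ _ //]]]|_] /=.
apply/allpairsPdep/idP => [[s' [k' [_ + [-> ->]]]]|h]; first by rewrite mem_index_iota.
by exists s, i; rewrite mem_enum mem_index_iota.
Qed.

Let dependsE m x c : depends_on Y (L m c)
  (coord_event x m `&` [set w | Z m w = c]).
Proof.
move=> w w' e [h /ffunP Zc].
have e1 s k : (k <= m s)%N -> N s (tau k) w = N s (tau k) w'.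
  move=> km; rewrite !(counting_sum_increments (N_poisson s) tau_mono)//.
  apply: eq_bigr => j _; apply: (e (inl (s, (j : nat)))).
  by rewrite inl_L (leq_trans (ltn_ord j)).
split; last by apply/ffunP => s; rewrite -Zc !ffunE e1.
move=> s k km; rewrite -h// !XE -e1//; apply: eq_bigr => i _; apply/esym.
apply: (e (inr ((i : nat), s))); rewrite inr_L -Zc ffunE.
apply: leq_trans (ltn_ord i) _; case: (N_poisson s) => /(_ w)[_ + _] _ _; apply.
exact: tau_mono.
Qed.

Let mcoord x m : measurable (coord_event x m).
Proof.
by apply: (measurable_setI_countable (Z := Z m)) => c;
  exact: (measurable_depends mY (@dependsE m x c)).
Qed.

Let factor x (s : 'I_d) K : \bar R := (if (x K s <= x K.+1 s)%N then
  compound_poisson (mu s) (lam s * ((tau K.+1)%:num - (tau K)%:num))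
    (axis s (x K.+1 s - x K s)%N) else 0)%E.

Let coord_step x m m' j : (forall s, m' s = (m s + (s == j))%N) ->
  tau (m j) < tau (m j).+1 ->
  P (coord_event x m') = (P (coord_event x m) * factor x j (m j))%E.
Proof.
move=> m'E taum.
have -> : coord_event x m' =
    coord_event x m `&` [set w | X (m j).+1 w j = x (m j).+1 j].
  apply/seteqP; split => [w h|w [h hj] s k].
    split=> [s k km|]; first by apply: h; rewrite m'E (leq_trans km)// leq_addr.
    by apply: h; rewrite m'E eqxx addn1.
  rewrite m'E; case: eqP => [->|_]; last by rewrite addn0; exact: h.
  by rewrite addn1 leq_eqVlt => /orP[/eqP -> //|/ltnSE]; exact: h.
have XS w : X (m j).+1 w j = (X (m j) w j +
    \sum_(i < increment (N j) (tau (m j)) (tau (m j).+1) w)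
      tnth (U (N j (tau (m j)) w + i)%N w) j)%N.
  rewrite !XE -(counting_increment (N_poisson j) w (ltW taum)).
  exact: (sum_ord_addn _ _ (fun i => tnth (U i w) j)).
rewrite /factor; case: ifPn => [le|nle]; last first.
  rewrite mule0 (_ : _ `&` _ = set0) ?measure0//; apply/seteqP; split => // w [h] /=.
  by rewrite XS h// => e; move: nle; rewrite -e leq_addr.
(* [Z m] records the counts of all coordinates, so that the past of each is decided by finitely many
   variables; only the j-th count sets the start of the new block. *)
rewrite -(probability_compound_step mY Y_indep (q := inl (j, m j)) (Z := Z m)
  (n := fun c => c j) (idx := fun i => inr (i, j)) (cnt := id)
  (val := axis j) (L := L m)) //.
- congr (P _); apply/seteqP; split => w /= [h e]; split=> //.
    rewrite (axis_sum _ _ (fun i => tnth (U (Z m w j + i)%N w) j)); congr axis.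
    by rewrite ffunE -e XS h// addKn.
  rewrite XS h//; move: e.
  rewrite (axis_sum _ _ (fun i => tnth (U (Z m w j + i)%N w) j)) ffunE.
  by move=> /axis_inj ->; rewrite subnKC.
- by rewrite mulr_gt0// subr_gt0.
- by move=> k; case: (N_poisson j) => _ _; exact.
- by move=> i u; exact: U_law.
- by move=> i i' [].
- by move=> c; rewrite inl_L ltnn.
- by move=> c i ci; rewrite inr_L ltnNge ci.
Qed.

Let path_coord x K : path_event X x K = coord_event x (fun=> K).
Proof.
apply/seteqP; split => [w h s k kK|w h k kK]; first by rewrite h.
by apply/ffunP => s; exact: h.
Qed.

Lemma measurable_path_coord K x : measurable (path_event X x K).
Proof. by rewrite path_coord. Qed.

Lemma probability_path_coordS (K : nat) (x : nat -> {ffun 'I_d -> nat}) :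
  tau K < tau K.+1 ->
  P (path_event X x K.+1) = (P (path_event X x K) * \prod_(s < d)
    if (x K s <= x K.+1 s)%N then
      compound_poisson (mu s) (lam s * ((tau K.+1)%:num - (tau K)%:num))
        (axis s (x K.+1 s - x K s)%N) else 0)%E.
Proof.
move=> tauK; rewrite !path_coord.
(* The boolean counts as 0 or 1: the first j coordinates have moved on to index K + 1, the others
   wait at K. *)
have step j : (j <= d)%N -> P (coord_event x (fun s => K + (s < j))%N) =
    (P (coord_event x (fun=> K)) * \prod_(s < d | (s < j)%N) factor x s K)%E.
  elim: j => [_|j IH jd].
    by rewrite big_pred0// mule1; under eq_fun do rewrite addn0.
  rewrite (@coord_step _ (fun s => K + (s < j))%N _ (Ordinal jd)).
  - rewrite IH ?(ltnW jd)// ltnn addn0 -muleA; congr (_ * _)%E.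
    rewrite [RHS](bigD1 (Ordinal jd)) ?ltnS//= muleC; congr (_ * _)%E.
    by apply: eq_bigl => s; rewrite ltnS ltn_neqAle -val_eqE andbC.
  - move=> s; rewrite ltnS leq_eqVlt -val_eqE/= -addnA; congr addn.
    by case: ltngtP.
  - by rewrite /= ltnn addn0.
have := step d (leqnn d).
rewrite (eq_bigl xpredT) => [<-|s]; last exact: ltn_ord.
by congr (P (coord_event x _)); apply/funext => s; rewrite ltn_ord addn1.
Qed.

End coordinate_compound.

(* Both sides solve Panjer's recursion in every coordinate. *)
Lemma compound_poisson_prod (R : realType) (d : nat) (lam : 'I_d -> R) (th : R)
    (mu : 'I_d -> {ffun 'I_d -> nat} -> R) (nu : {ffun 'I_d -> nat} -> R) :
  (forall s, 0 < lam s) -> 0 < th -> (forall s u, 0 <= mu s u) -> (forall u, 0 <= nu u) ->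
  (forall s, \esum_(u in [set: {ffun 'I_d -> nat}]) (mu s u)%:E = 1)%E ->
  (forall s u, mu s u != 0 -> u = axis s (u s)) ->
  nu 0 = 0 -> (forall u, u != 0 -> th * nu u = \sum_s lam s * mu s u) ->
  th = \sum_s lam s * (1 - mu s 0) ->
  forall v, compound_poisson nu th v =
    (\prod_(s < d) compound_poisson (mu s) (lam s) (axis s (v s)))%E.
Proof.
move=> lam0 th0 mu0 nu0 mu1 muA nu00 nuE thE.
have axis0 (s : 'I_d) : axis s 0 = 0.
  by apply/ffunP => r; rewrite !ffunE; case: ifP.
have gfin s v : compound_poisson (mu s) (lam s) v \is a fin_num.
  by apply: compound_poisson_fin_num => //; rewrite mu1.
pose g s v := fine (compound_poisson (mu s) (lam s) v).
have gE s v : compound_poisson (mu s) (lam s) v = (g s v)%:E by rewrite fineK.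
have g0 s v : 0 <= g s v by rewrite fine_ge0// compound_poisson_ge0.
pose h (v : {ffun 'I_d -> nat}) := (\prod_(s < d) g s (axis s (v s)))%:E.
move=> v; under eq_bigr do rewrite gE.
rewrite prodEFin -/(h v).
apply: (weighted_recursion_unique (h := h) (c := fun s u => lam s * ((u s)%:R * mu s u))).
- by move=> s u ->; rewrite mul0r mulr0.
- rewrite compound_poisson0// nu00 subr0 mulr1 /h; congr EFin.
  rewrite thE -sumrN expR_sum; apply: eq_bigr => s _.
  by rewrite ffunE axis0 /g compound_poisson0.
- move=> s {}v; rewrite compound_poisson_weighted//; apply: eq_esum => u _.
  congr (_%:E * _)%E; have [->|us] := eqVneq (u s) 0%N; first by rewrite !mul0r !mulr0.
  have u0 : u != 0 by apply: contraNneq us => ->; rewrite ffunE.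
  rewrite mulrCA nuE// (bigD1 s)//= big1 ?addr0; first by rewrite mulrCA.
  (* As u_s is nonzero, u lies on no axis other than the s-th, so only the term r = s survives. *)
  move=> r rs; have [->|/muA uE] := eqVneq (mu r u) 0; first by rewrite mulr0.
  by move: us; rewrite uE ffunE [s == r]eq_sym (negbTE rs).
- move=> s {}v; rewrite /h (bigD1 s)//= EFinM muleA.
  have {1}-> : v s = axis s (v s) s by rewrite ffunE eqxx.
  rewrite -gE compound_poisson_weighted// muleC -ge0_esumZl; first last.
  + by move=> u; rewrite mule_ge0 ?compound_poisson_ge0// lee_fin !mulr_ge0// ltW.
  + by rewrite prodr_ge0.
  rewrite esum_mkcond [RHS]esum_mkcond; apply: eq_esum => u _.
  (* Off the s-th axis both terms vanish. On it, u <= v only constrains coordinate s, and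
     subtracting u from v changes the s-th factor alone. *)
  have [->|/muA uE] := eqVneq (mu s u) 0.
    by rewrite !mulr0 !mul0e !mule0; do 2 case: ifP.
  have le : vle u (axis s (v s)) = vle u v.
    apply/vleP/vleP => le r; rewrite uE ffunE; case: eqP => // ->.
      by have := le s; rewrite uE !ffunE eqxx.
    by rewrite ffunE eqxx; have := le s; rewrite uE !ffunE eqxx.
  have -> : (u \in [set u | vle u (axis s (v s))]) = (u \in [set u | vle u v]).
    by apply/idP/idP; rewrite !inE/= le.
  case: ifP => // _; rewrite muleCA gE -!EFinM; congr EFin; congr *%R.
  rewrite mulrC [RHS](bigD1 s)//=; congr *%R.
    congr (g _ _); apply/ffunP => r; rewrite uE !ffunE eqxx.
    by case: eqP => // ->; rewrite ?eqxx.
  apply: eq_bigr => r rs; congr (g _ (axis _ _)).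
  by rewrite uE !ffunE (negbTE rs) subn0.
Qed.

(** * Law of the selected jump vector *)

Lemma vec_select {T : Type} {d : nat} (A : 'I_d -> set T) (U : T -> d.-tuple nat) s w :
  partition setT A setT -> A s w -> vec (select A U w) = axis s (tnth (U w) s).
Proof.
move=> [_ tA _] Asw; apply/ffunP => r; rewrite !ffunE tnth_mktuple.
case: eqP => [->|rs]; first by rewrite mem_set// mul1n.
rewrite memNset// => Arw; apply: rs; apply: tA => //.
by exists w.
Qed.

Lemma vec_zero d : vec (zero_tuple d) = 0.
Proof. by apply/ffunP => s; rewrite !ffunE tnth_mktuple. Qed.

Lemma set_vec_select {T : Type} {d : nat} (A : 'I_d -> set T) (U : T -> d.-tuple nat) u :
  partition setT A setT -> [set w | vec (select A U w) = u] =
  \big[setU/set0]_(s < d) (A s `&` [set w | axis s (tnth (U w) s) = u]).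
Proof.
move=> pA; rewrite -bigcup_seq; apply/seteqP; split => [w /= uE|w [s _ [As /= <-]]].
  have [s _ As] : cover setT A w by case: pA => ->.
  exists s; first exact: mem_index_enum.
  by split=> //=; rewrite -uE (vec_select U pA As).
by rewrite (vec_select U pA As).
Qed.

(** Exactly one A_s occurs, and on it the selected vector lies on the s-th axis; its law is thus the
    mixture of the axis laws with the weights of the A_s. *)
Lemma probability_vec_select {dT} {T : measurableType dT} {R : realType}
    (P : probability T R) {d : nat} (A : 'I_d -> set T) (U : T -> d.-tuple nat)
    (p : 'I_d -> R) (mu : 'I_d -> {ffun 'I_d -> nat} -> R) u :
  partition setT A setT -> (forall s, measurable (A s)) ->
  (forall s, measurable [set w | axis s (tnth (U w) s) = u]) ->
  (forall s, P (A s) = (p s)%:E) ->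
  (forall s, P [set w | axis s (tnth (U w) s) = u] = (mu s u)%:E) ->
  (forall s, P (A s `&` [set w | axis s (tnth (U w) s) = u]) =
     P (A s) * P [set w | axis s (tnth (U w) s) = u])%E ->
  measurable [set w | vec (select A U w) = u] /\
  P [set w | vec (select A U w) = u] = (\sum_s p s * mu s u)%:E.
Proof.
move=> pA mA mU PA PU PAU; rewrite set_vec_select//; split.
  by apply: bigsetU_measurable => s _; exact: measurableI.
rewrite measure_bigsetU_ord => [|s|]; [|exact: measurableI|].
  by rewrite -sumEFin; apply: eq_bigr => s _; rewrite [LHS]PAU PA PU.
by case: pA => _ tA _; exact: trivIset_setIr.
Qed.

(** * From paths on a grid to finite-dimensional distributions *)

Lemma same_pmf_preimage {d1 d2} {T1 : measurableType d1} {T2 : measurableType d2}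
    {R : realType} (P1 : probability T1 R) (P2 : probability T2 R) {C : countType}
    (X1 : T1 -> C) (X2 : T2 -> C) (B : set C) :
  (forall c, measurable [set w | X1 w = c]) -> (forall c, measurable [set w | X2 w = c]) ->
  (forall c, P1 [set w | X1 w = c] = P2 [set w | X2 w = c]) ->
  P1 [set w | B (X1 w)] = P2 [set w | B (X2 w)].
Proof.
move=> m1 m2 h.
rewrite (esum_probability P1 (measurable_countable_preimage B m1) m1).
rewrite (esum_probability P2 (measurable_countable_preimage B m2) m2).
apply: eq_esum => c _; have [Bc|nBc] := pselect (B c).
  rewrite (_ : _ `&` _ = [set w | X1 w = c]); last first.
    by apply/seteqP; split => [w []//|w /= Xc]; split; rewrite //= Xc.
  rewrite (_ : _ `&` _ = [set w | X2 w = c]); first exact: h.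
  by apply/seteqP; split => [w []//|w /= Xc]; split; rewrite //= Xc.
rewrite (_ : _ `&` _ = set0); last by apply/seteqP; split => // w /= [] /[swap] ->.
by rewrite (_ : _ `&` _ = set0) ?measure0//; apply/seteqP; split => // w /= [] /[swap] ->.
Qed.

(** The requested times may be unsorted or repeated. Sorting them together with 0 and removing
    repetitions gives a strict grid; the requested values are read off the path on it, which takes
    countably many values. *)
Lemma same_fdd_of_paths {d1 d2} {T1 : measurableType d1} {T2 : measurableType d2}
    {R : realType} (P1 : probability T1 R) (P2 : probability T2 R) {d : nat}
    (X1 : {nonneg R} -> T1 -> d.-tuple nat) (X2 : {nonneg R} -> T2 -> d.-tuple nat) :
  (forall tau K (x : nat -> {ffun 'I_d -> nat}), tau 0%N = 0%:nng ->
     nondecreasing_seq tau -> (forall k, (k < K)%N -> tau k < tau k.+1) ->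
     [/\ measurable (path_event (fun k w => vec (X1 (tau k) w)) x K),
         measurable (path_event (fun k w => vec (X2 (tau k) w)) x K) &
         P1 (path_event (fun k w => vec (X1 (tau k) w)) x K) =
         P2 (path_event (fun k w => vec (X2 (tau k) w)) x K)]) ->
  same_fdd P1 P2 X1 X2.
Proof.
move=> h n t B _.
have [zero zeroE] : exists z : {nonneg R}, z = 0%:nng by eexists.
pose s : seq {nonneg R} := sort <=%O (undup (zero :: tval t)).
pose K := (size s).-1.
(* Frozen after the last grid point: [tau] must be nondecreasing on all of nat, and strictly
   increasing only before K. *)
pose tau k := nth zero s (minn k K).
have s0 : zero \in s by rewrite mem_sort mem_undup inE eqxx.
have sizes : size s = K.+1 by rewrite prednK// lt0n size_eq0; apply: contraTneq s0 => ->.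
have slt : sorted <%O s.
  by rewrite lt_sorted_uniq_le sort_uniq undup_uniq sort_le_sorted.
have minK k : (minn k K < size s)%N by rewrite sizes ltnS geq_minr.
have tau_mono : nondecreasing_seq tau.
  move=> i j ij; rewrite /tau; apply: (sorted_leq_nth le_trans le_refl); rewrite ?inE//.
    exact: sort_le_sorted.
  by rewrite leq_min geq_minr andbT (leq_trans (geq_minl _ _)).
have tau_lt k : (k < K)%N -> tau k < tau k.+1.
  move=> kK; rewrite /tau; apply: (sorted_ltn_nth lt_trans) => //; rewrite ?inE//.
  by rewrite (minn_idPl kK) (minn_idPl (ltnW kK)).
have tauE u : u \in s -> tau (index u s) = u.
  move=> us; rewrite /tau (minn_idPl _) ?nth_index//.
  by rewrite -ltnS -sizes index_mem.
have tau0 : tau 0%N = zero.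
  apply/le_anti/andP; split; last by rewrite zeroE -num_le/=.
  by rewrite -[leRHS](tauE _ s0); exact: tau_mono.
pose W (T : Type) (X : {nonneg R} -> T -> d.-tuple nat) w : {ffun 'I_K.+1 -> {ffun 'I_d -> nat}} :=
  [ffun k : 'I_K.+1 => vec (X (tau k) w)].
pose B' (c : {ffun 'I_K.+1 -> {ffun 'I_d -> nat}}) :=
  B [tuple [tuple c (inord (index (tnth t k) s)) r | r < d] | k < n].
have BE (T : Type) (X : {nonneg R} -> T -> d.-tuple nat) :
    [set w | B [tuple X (tnth t k) w | k < n]] = [set w | B' (W _ X w)].
  apply/seteqP; suff e w : [tuple X (tnth t k) w | k < n] =
      [tuple [tuple W _ X w (inord (index (tnth t k) s)) r | r < d] | k < n].
    by split => w /=; rewrite /B' e.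
  apply: eq_from_tnth => k; rewrite !tnth_mktuple; apply: eq_from_tnth => r.
  have ts : tnth t k \in s by rewrite mem_sort mem_undup inE mem_tnth orbT.
  by rewrite tnth_mktuple !ffunE inordK ?tauE// -sizes index_mem.
have WE (T : Type) (X : {nonneg R} -> T -> d.-tuple nat) c :
    [set w | W _ X w = c] = path_event (fun k w => vec (X (tau k) w)) (fun k => c (inord k)) K.
  apply/seteqP; split => [w <- k kK|w hw]; first by rewrite ffunE inordK.
  by apply/ffunP => k; rewrite ffunE hw ?inord_val// -ltnS.
rewrite !BE; apply: same_pmf_preimage => c; rewrite !WE;
  by case: (h tau K (fun k => c (inord k)) (etrans tau0 zeroE) tau_mono tau_lt).
Qed.

Theorem lemma5p2 (R : realType) (d : nat) (d_gt0 : (0 < d)%N)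
  (lam : 'I_d -> R) (lam_gt0 : forall s, 0 < lam s)
  (dt : measure_display) (Tt : measurableType dt) (Pt : probability Tt R)
  (Nt : 'I_d -> {nonneg R} -> {RV Pt >-> nat})
  (Nt_poisson : forall s, poisson_process (lam s) (Nt s))
  (Nt_indep : mutual_indep Pt (fun s : 'I_d => sigma_of (Nt s)))
  (Ut : nat -> {RV Pt >-> d.-tuple nat})
  (Ut_indep : mutual_indep Pt (fun i : nat => sigma_of (fun _ : unit => Ut i)))
  (Ut_ident : forall (i : nat) (B : set (d.-tuple nat)), measurable B ->
     distribution Pt (Ut i) B = distribution Pt (Ut 0%N) B)
  (Ut_coord_indep : forall i : nat, mutual_indep Pt
     (fun s : 'I_d => sigma_of (fun (_ : unit) w => tnth (Ut i w) s)))
  (Ut_Nt_indep : indep Pt (sigma_of Ut)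
     (sigma_of (fun (st : 'I_d * {nonneg R}) => Nt st.1 st.2)))
  (A : nat -> 'I_d -> set Tt)
  (A_meas : forall i s, measurable (A i s))
  (A_partition : forall i, partition setT (A i) setT)
  (A_prob : forall i s, Pt (A i s) = (lam s / \sum_(r < d) lam r)%:E)
  (A_indep : mutual_indep Pt (fun i : nat => <<s range (A i) >>))
  (A_Ut_indep : indep Pt <<s \bigcup_i range (A i) >> (sigma_of Ut))
  (p0 : R)
  (p0E : p0 = (\sum_(s < d) fine (Pt [set w | tnth (Ut 0%N w) s = 0%N]) * lam s)
              / \sum_(s < d) lam s)
  (p0_lt1 : p0 < 1)
  (dT : measure_display) (T : measurableType dT) (P : probability T R)
  (U : nat -> {RV P >-> d.-tuple nat})
  (U_indep : mutual_indep P (fun i : nat => sigma_of (fun _ : unit => U i)))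
  (U_dist : forall (i : nat) (B : set (d.-tuple nat)), measurable B ->
     distribution P (U i) B =
     cond_prob Pt [set w | B (select (A 0%N) (Ut 0%N) w)]
                  [set w | select (A 0%N) (Ut 0%N) w <> zero_tuple d])
  (N : {nonneg R} -> {RV P >-> nat})
  (N_poisson : poisson_process ((\sum_(s < d) lam s) * (1 - p0)) N)
  (N_U_indep : indep P (sigma_of N) (sigma_of U)) :
  same_fdd P Pt (compound_process (fun _ : 'I_d => N) U)
                (compound_process Nt Ut).
Proof.
pose mu s u := fine (Pt [set w | axis s (tnth (Ut 0%N w) s) = u]).
pose nu u := fine (P [set w | vec (U 0%N w) = u]).
pose Lam := \sum_(r < d) lam r.
have Lam_gt0 : 0 < Lam.
  rewrite /Lam (bigD1 (Ordinal d_gt0))//= ltr_wpDr// sumr_ge0// => s _.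
  exact: ltW.
have th_gt0 : 0 < Lam * (1 - p0) by rewrite mulr_gt0// subr_gt0.
have Ut_law i s u : Pt [set w | axis s (tnth (Ut i w) s) = u] = (mu s u)%:E.
  rewrite /mu fineK; last first.
    apply: fin_num_measure.
    exact: (measurable_RV_tuple (Ut 0%N) [set v | axis s (tnth v s) = u]).
  exact: (Ut_ident i _ (measurable_nat_tuple [set v | axis s (tnth v s) = u])).
have U_law i u : P [set w | vec (U i w) = u] = (nu u)%:E.
  rewrite /nu fineK; last first.
    apply: fin_num_measure.
    exact: (measurable_RV_tuple (U 0%N) [set v | vec v = u]).
  have mB := measurable_nat_tuple [set v : d.-tuple nat | vec v = u].
  by have := U_dist i _ mB; rewrite -(U_dist 0%N _ mB).
have mu_ge0 s u : 0 <= mu s u by rewrite fine_ge0.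
have nu_ge0 u : 0 <= nu u by rewrite fine_ge0.
have mu1 s : (\esum_(u in [set: {ffun 'I_d -> nat}]) (mu s u)%:E = 1)%E.
  apply: (esum_law (P := Pt) (Y := fun (_ : unit) w => tnth (Ut 0%N w) s)
    _ (val := axis s) (i := tt)) => // _ c.
  exact: (measurable_RV_tuple (Ut 0%N) [set v | tnth v s = c]).
have muA s u : mu s u != 0 -> u = axis s (u s).
  apply: contra_neq_eq => uN; rewrite /mu (_ : [set w | _] = set0) ?measure0//.
  apply/seteqP; split => // w /= e; move/eqP: uN; apply.
  by rewrite -e; congr axis; rewrite ffunE eqxx.
have selP u : measurable [set w | vec (select (A 0%N) (Ut 0%N) w) = u] /\
    Pt [set w | vec (select (A 0%N) (Ut 0%N) w) = u] =
    (\sum_s lam s / Lam * mu s u)%:E.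
  apply: probability_vec_select => //.
    by move=> s; exact: (measurable_RV_tuple (Ut 0%N) [set v | axis s (tnth v s) = u]).
  move=> s; apply: A_Ut_indep.
    by apply: sub_sigma_algebra; exists 0%N => //; exists s.
  apply: (@sigma_of_preimage _ _ _ _ _ _ 0%N [set v | axis s (tnth v s) = u]).
  exact: measurable_nat_tuple.
(* So p0 is the mass that the selected vector gives to 0, and 1 - p0 is the probability of the
   conditioning event. *)
have p0E' : p0 = \sum_s lam s / Lam * mu s 0.
  rewrite p0E -/Lam mulr_suml; apply: eq_bigr => s _.
  rewrite -mulrA mulrC; congr (_ * fine (Pt _)).
  apply/seteqP; split => w /= [e]; last by move/ffunP: e => /(_ s); rewrite !ffunE eqxx.
  by rewrite e; apply/ffunP => r; rewrite !ffunE; case: ifP.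
have selN : [set w | select (A 0%N) (Ut 0%N) w <> zero_tuple d] =
    ~` [set w | vec (select (A 0%N) (Ut 0%N) w) = 0].
  apply/seteqP; split => w /= h e; apply: h; last by rewrite e vec_zero.
  by apply: (@vec_inj d); rewrite vec_zero.
have PselN : Pt [set w | select (A 0%N) (Ut 0%N) w <> zero_tuple d] = (1 - p0)%:E.
  by rewrite selN probability_setC ?(selP 0).2 ?p0E'//; exact: (selP 0).1.
have nu_cond u : (nu u)%:E = cond_prob Pt
    [set w | vec (select (A 0%N) (Ut 0%N) w) = u]
    [set w | select (A 0%N) (Ut 0%N) w <> zero_tuple d].
  rewrite -(U_law 0%N).
  exact: (U_dist 0%N _ (measurable_nat_tuple [set v | vec v = u])).
have nu0 : nu 0 = 0.
  apply: EFin_inj; rewrite nu_cond /cond_prob selN setICr measure0 mul0e//.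
have lamE u : \sum_s lam s / Lam * mu s u = (\sum_s lam s * mu s u) / Lam.
  by rewrite mulr_suml; apply: eq_bigr => s _; rewrite mulrAC.
(* Selection divides the intensities by [Lam] and conditioning divides by 1 - p0; the rate of [N]
   restores both factors. *)
have nuE u : u != 0 -> Lam * (1 - p0) * nu u = \sum_s lam s * mu s u.
  move=> u0.
  have -> : nu u = (\sum_s lam s / Lam * mu s u) / (1 - p0).
    apply: EFin_inj; rewrite nu_cond /cond_prob PselN selN setIidl; last first.
      by move=> w /= ->; exact/eqP.
    by rewrite (selP u).2 EFinM inver (gt_eqF (_ : 0 < 1 - p0))// subr_gt0.
  rewrite lamE; field.
  by rewrite !gt_eqF ?subr_gt0.
(* Equality of the two increment laws on an interval of length [tau], which multiplies all the
   rates. *)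
have key (tau : R) v : 0 < tau -> compound_poisson nu (Lam * (1 - p0) * tau) v =
    (\prod_(s < d) compound_poisson (mu s) (lam s * tau) (axis s (v s)))%E.
  move=> tau_gt0; apply: compound_poisson_prod => //.
  - by move=> s; rewrite mulr_gt0.
  - by rewrite mulr_gt0.
  - move=> u /nuE e; rewrite mulrAC e mulr_suml.
    by apply: eq_bigr => s _; rewrite mulrAC.
  - rewrite p0E' lamE.
    have -> : \sum_s lam s * tau * (1 - mu s 0) =
        tau * (Lam - \sum_s lam s * mu s 0).
      by rewrite mulrBr !mulr_sumr -sumrB; apply: eq_bigr => s _; ring.
    by field; rewrite gt_eqF.
apply: same_fdd_of_paths => tau K x tau0 tau_mono tau_lt.
split.
- exact: (measurable_path_vector U N_poisson tau_mono tau0).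
- exact: (measurable_path_coord Ut Nt_poisson tau_mono tau0).
elim: K tau_lt => [_|K IH tau_lt].
  have path0 d' (T' : measurableType d') (Q : probability T' R)
      (N' : 'I_d -> {nonneg R} -> T' -> nat) U' :
      (forall s w, N' s (tau 0%N) w = 0%N) ->
      Q (path_event (fun k w => vec (compound_process N' U' (tau k) w)) x 0) =
      ((x 0%N == 0)%:R)%:E.
    move=> N0; have X0 w : vec (compound_process N' U' (tau 0%N) w) = 0.
      by apply/ffunP => s; rewrite !ffunE tnth_compound_process N0 big_ord0.
    case: eqP => [x0|x0].
      rewrite (_ : path_event _ _ _ = setT) ?probability_setT//.
      by apply/seteqP; split=> // w _ [_|//]; rewrite X0 x0.
    rewrite (_ : path_event _ _ _ = set0) ?measure0//.
    by apply/seteqP; split=> // w /(_ 0%N (leqnn _)); rewrite X0 => /esym.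
  rewrite path0 => [|s w]; first rewrite path0 // => s w.
  - by rewrite tau0; case: (Nt_poisson s) => /(_ w)[].
  - by rewrite tau0; case: N_poisson => /(_ w)[].
rewrite (probability_path_vectorS th_gt0 N_poisson U_indep N_U_indep U_law)//; last exact: tau_lt.
rewrite (probability_path_coordS lam_gt0 Nt_poisson Nt_indep Ut_indep
  Ut_coord_indep Ut_Nt_indep Ut_law)//; last exact: tau_lt.
rewrite IH; last by move=> k kK; apply: tau_lt; exact: leqW.
congr (_ * _)%E.
have dtau : 0 < (tau K.+1)%:num - (tau K)%:num by rewrite subr_gt0; exact: tau_lt.
(* If some coordinate of x decreases, the left factor is 0 by definition and the right one has a
   zero factor in that coordinate. *)
case: ifPn => [/vleP le|/forallPn [s nle]].
  by rewrite key//; apply: eq_bigr => s _; rewrite le ffunE.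
by rewrite (bigD1 s)//= (negbTE nle) mul0e.
Qed.
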